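(* Let $w:=\dfrac{\beta^+}{\beta^++\beta^-}\in\mathcal W_0$. Then, as $n\to\infty$, $H^n$ converges almost surely to $w$, as a sequence of random variables with values in $\mathcal W_0$ equipped with the weak topology.
   Context: Fix $T\in(0,\infty)$; write $[0,1]^2_T=[0,1]^2\times[0,T]$ and $[n]=\{1,\dots,n\}$. All $L^p$ spaces are with respect to Lebesgue measure. Let $Q^n_1=[0,1/n]$, $Q^n_i=((i-1)/n,i/n]$ for $2\le i\le n$, and $Q^n_{i,j}=Q^n_i\times Q^n_j$. Rates. $\beta^+,\beta^-:[0,1]^2\times[0,T]\to[0,\infty)$ are measurable, with $\beta^\pm_t(x,y)=\beta^\pm(x,y,t)$. For each $n$ and $i,j\in[n]$, $\beta^{n,\pm}_{i,j}:[0,T]\to[0,\infty)$ are measurable and $\beta^{n,\pm}_t(x,y)=\beta^{n,\pm}(x,y,t)=\sum_{i,j=1}^n\beta^{n,\pm}_{i,j}(t)\mathbf 1_{Q^n_{i,j}}(x,y)$. Standing assumptions: (a) $\beta^{n,\pm},\beta^\pm\in L^1([0,1]^2_T)$ and $\beta^{n,\pm}\to\beta^\pm$ in $L^1([0,1]^2_T)$; (b) there is $c_\beta>0$ with $\beta^{n,\pm}_{i,j}(t)\ge c_\beta$ for all $n\ge1$, $i,j\in[n]$, $t\in[0,T]$; (c) $t\mapsto\beta^\pm_t(x,y)$ is bounded and left-continuous for a.e. $(x,y)\in[0,1]^2$, and $t\mapsto\beta^{n,\pm}_{i,j}(t)$ is bounded and left-continuous for all $i,j\in[n]$ and all large enough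 $n$. Graph process. $a(n)\in(0,\infty)$ with $a(n)\to\infty$. For each $n$, $\{X^n_{i,j}(t):t\in[0,T]\}_{i,j\in[n]}$ are $n^2$ mutually independent (càdlàg) Markov chains on $\{0,1\}$, with deterministic initial values $X^n_{i,j}(0)=x^n_{i,j}\in\{0,1\}$, jumping at time $t$ from $0$ to $1$ at rate $a(n)\beta^{n,+}_{i,j}(t)$ and from $1$ to $0$ at rate $a(n)\beta^{n,-}_{i,j}(t)$; all are defined on one probability space $(\Omega,\mathcal F,\mathbb P)$. Put $H^n(x,y,t)=H^n_t(x,y)=\sum_{i,j=1}^nX^n_{i,j}(t)\mathbf 1_{Q^n_{i,j}}(x,y)$. $\mathcal W_0$ is the set of measurable $\phi:[0,1]^2\times[0,T]\to\mathbb R$ with $0\le\phi\le1$ a.e. (functions identified if equal a.e.). The weak topology on $\mathcal W_0$ is the one inherited from the weak topology of $L^2([0,1]^2_T)$; it is compact and metrizable. *)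

(* Defs.v *)
From HB Require Import structures.
From mathcomp Require Import all_boot all_order all_algebra.
From mathcomp Require Import all_classical all_reals all_analysis.

Set Implicit Arguments.
Unset Strict Implicit.
Unset Printing Implicit Defensive.
Import Order.TTheory GRing.Theory Num.Theory.
Import numFieldNormedType.Exports.
Local Open Scope classical_set_scope.
Local Open Scope ring_scope.

(* Copy of R carrying the Borel sigma-algebra on which [lebesgue_measure] is
   defined. *)
Notation BR := measurableTypeR.

Section domain.
Context {R : realType}.
Local Open Scope ereal_scope.

Definition unit_square : set (BR R * BR R) := `[0%R, 1%R] `*` `[0%R, 1%R].

Definition cube (T : R) : set (BR R * BR R * BR R) := unit_square `*` `[0%R, T].

Lemma measurable_cube (T : R) : measurable (cube T).
Proof. by do ?[apply: measurableX]; exact: measurable_itv. Qed.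

Definition lebesgue2 : {measure set (BR R * BR R) -> \bar R} :=
  @lebesgue_measure R \x @lebesgue_measure R.

Definition lebesgue3 : {measure set (BR R * BR R * BR R) -> \bar R} :=
  lebesgue2 \x @lebesgue_measure R.

Definition lebesgue_cube (T : R) : {measure set (BR R * BR R * BR R) -> \bar R} :=
  mrestr lebesgue3 (measurable_cube T).

End domain.

Section weak_topology.
Context {R : realType} (T : R).

(* Library L^2 space: classes modulo a.e. equality for [lebesgue_cube T]. *)
Definition L2 : Type := LspaceType2 (lebesgue_cube T).

HB.instance Definition _ := gen_eqMixin L2.
HB.instance Definition _ := gen_choiceMixin L2.

(* By Riesz representation, [pairing f] lists the values at f of all the
   continuous linear functionals on L^2. *)
Definition pairing (f : L2) : {ptws L2 -> R} :=
  fun g : L2 => \int[lebesgue_cube T]_p (f p * g p).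

Definition weakL2 : Type := initial_topology pairing.

HB.instance Definition _ := Topological.on weakL2.

(* Used as a type, this set carries the subspace topology. *)
Definition W0 : set weakL2 :=
  [set f : L2 | {ae lebesgue_cube T, forall p, 0 <= f p <= 1}].

End weak_topology.
Arguments W0 {R} T.

Section step_functions.
Context {R : realType}.

(* Indices start at 0: [cell n i] is the interval Q^n_{i+1}. *)
Definition cell (n : nat) (i : 'I_n) : set R :=
  if i == 0%N :> nat then `[0, n%:R^-1]%classic
  else `]i%:R / n%:R, i.+1%:R / n%:R]%classic.

Definition step (n : nat) (f : 'I_n -> 'I_n -> R -> R) (p : BR R * BR R * BR R) : R :=
  \sum_(i < n) \sum_(j < n) f i j p.2 * \1_(cell i `*` cell j) p.1.

End step_functions.

Section rates.
Context {R : realType} (T : R).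

Definition bounded_left_continuous (f : R -> R) : Prop :=
  [bounded f t | t in `[0, T]%classic] /\
  forall t : R, 0 < t <= T -> f s @[s --> t^'-] --> f t.

Record admissible_rates (c : R) (beta : BR R * BR R * BR R -> R)
    (betan : forall n, 'I_n -> 'I_n -> R -> R) : Prop := {
  rate_measurable : measurable_fun (cube T) beta;
  rate_ge0 : forall p, cube T p -> 0 <= beta p;
  raten_measurable : forall n (i j : 'I_n),
    measurable_fun `[0, T]%classic (betan n i j);
  raten_ge0 : forall n (i j : 'I_n) (t : R), 0 <= t <= T -> 0 <= betan n i j t;
  rate_L1 : (@lebesgue3 R).-integrable (cube T) (EFin \o beta);
  raten_L1 : forall n,
    (@lebesgue3 R).-integrable (cube T) (EFin \o step (betan n));
  raten_cvg : (\int[@lebesgue3 R]_(p in cube T)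
      (`|step (betan n) p - beta p|%:E))%E @[n --> \oo] --> 0%E;
  raten_ge : forall n (i j : 'I_n) (t : R), 0 <= t <= T -> c <= betan n i j t;
  rate_blc : {ae @lebesgue2 R, forall z, unit_square z ->
    bounded_left_continuous (fun t => beta (z, t))};
  raten_blc : \forall n \near \oo, forall i j : 'I_n,
    bounded_left_continuous (betan n i j)
}.

End rates.

Definition borel_measurable {d : measure_display} {Omega : measurableType d}
    {E : topologicalType} (f : Omega -> E) : Prop :=
  forall B : set E, <<s open >> B -> measurable (f @^-1` B).

Section jump_chains.
Context {R : realType} {d : measure_display} {Omega : measurableType d}.
Variables (P : probability Omega R) (T : R).

Definition history (X : R -> Omega -> bool) (s : R) : set (set Omega) :=
  <<s \bigcup_(u in `[0, s]%classic) preimage_set_system setT (X u) measurable >>.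

(* For each t, the generator with rate [up t] from 0 to 1 and [down t] from 1
   to 0; [false] and [true] are the states 0 and 1. *)
Definition generator (up down : R -> R) (t : R) (x y : bool) : R :=
  match x, y with
  | false, true => up t
  | false, false => - up t
  | true, false => down t
  | true, true => - down t
  end.

(* [p s t x y] is the probability of being in state y at time t from state x
   at time s. The forward equation is in integral form since the rates are
   only measurable in time. *)
Record transition_function (q : R -> bool -> bool -> R)
    (p : R -> R -> bool -> bool -> R) : Prop := {
  transition_ge0 : forall (s t : R) x y, 0 <= s <= t -> t <= T -> 0 <= p s t x y;
  transition_sum1 : forall (s t : R) x, 0 <= s <= t -> t <= T ->
    \sum_(y : bool) p s t x y = 1;
  chapman_kolmogorov : forall (s t u : R) x y, 0 <= s <= t -> t <= u <= T ->
    p s u x y = \sum_(z : bool) p s t x z * p t u z y;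
  transition_measurable : forall (s : R) x y, 0 <= s ->
    measurable_fun `[s, T]%classic (fun u => p s u x y);
  kolmogorov_forward : forall (s t : R) x y, 0 <= s <= t -> t <= T ->
    p s t x y = (x == y)%:R +
      \int[lebesgue_measure]_(u in `[s, t]%classic)
        (\sum_(z : bool) p s u x z * q u z y)
}.

Definition cadlag (x : R -> bool) : Prop :=
  (forall t : R, 0 <= t < T -> x s @[s --> t^'+] --> x t) /\
  (forall t : R, 0 < t <= T -> cvg (x s @[s --> t^'-])).

Record jump_chain (up down : R -> R) (x0 : bool)
    (X : R -> {RV P >-> bool}) : Prop := {
  chain_init : forall omega, X 0 omega = x0;
  chain_cadlag : forall omega, cadlag (fun t => X t omega);
  chain_markov : exists2 p, transition_function (generator up down) p &
    forall (s t : R) A x y, 0 <= s <= t -> t <= T -> history X s A ->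
      P (A `&` [set omega | X s omega = x] `&` [set omega | X t omega = y]) =
      ((p s t x y)%:E * P (A `&` [set omega | X s omega = x]))%E
}.

Definition mutually_independent (I : finType) (F : I -> set (set Omega)) : Prop :=
  forall (J : {set I}) (A : I -> set Omega), (forall i, i \in J -> F i (A i)) ->
    fine (P (\bigcap_(i in [set` J]) A i)) = \prod_(i in J) fine (P (A i)).

End jump_chains.

(* Main.v *)
(** Average against the boxes of a countable pi-system generating the Borel sets
of the cube.  On a box, [H^n] minus its mean is a sum of [n^2] independent centred
terms of size [O(n^-2)], so its second moment is [O(n^-2)], which is summable: the
fluctuations vanish almost surely, whatever the speed of [a n].  The mean [U^n]
solves the forward equation, so [beta^(n,+) - (beta^(n,+) + beta^(n,-)) U^n] is
[1 / a n] times a time derivative of a function with values in [[0, 1]] and its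
integral over a box tends to 0.  By [L^1] convergence of the rates the same holds
for [(beta^+ + beta^-) (w - U^n)].  These functions are dominated by the integrable
[beta^+ + beta^-], so a pi-lambda argument passes from boxes to test functions; the
test function [1_box / (beta^+ + beta^-)] removes the weight.  The same argument
turns convergence on boxes into weak convergence in [W0]. *)

From HB Require Import structures.
Require Import Defs.
From mathcomp Require Import all_boot all_order all_algebra.
From mathcomp Require Import all_classical all_reals all_analysis.
From mathcomp Require Import finmap ring lra.
From mathcomp Require Import measurable_realfun simple_functions.
Set Implicit Arguments.
Unset Strict Implicit.
Unset Printing Implicit Defensive.
Import Order.TTheory GRing.Theory Num.Theory.
Import numFieldNormedType.Exports.
Local Open Scope classical_set_scope.
Local Open Scope ring_scope.

(** * Dominated sequences *)

(** Weak convergence involves uncountably many test functions, while every almost sure statement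
    costs a null set. Probability is therefore confined to countably many rational boxes; for a
    fixed outcome, the passage to all test functions is deterministic. Nothing relates the chains
    for different [n], so almost sure convergence has to come from a summable bound. The factor
    [beta^+ + beta^-] is only integrable; hence a domination argument in which a test function [g]
    has to make [B * g] integrable, which also admits the quotient that removes the weight. The
    lower bound [c] is assumed for the approximating rates and must be carried over to the limit
    before dividing. Finally, points of [W0] are classes chosen outcome by outcome, so the Borel
    measurability of [H^n] rests on the boxes as well: they describe the open sets of [W0]
    countably. *)

Section Rintegral_extra.
Context d (E : measurableType d) (R : realType) (mu : {measure set E -> \bar R}).

Lemma Rintegral_setD (f : E -> R) (A A' : set E) : measurable A -> measurable A' ->
  A' `<=` A -> mu.-integrable A (EFin \o f) ->
  \int[mu]_(x in A `\` A') f x = \int[mu]_(x in A) f x - \int[mu]_(x in A') f x.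
Proof.
move=> mA mA' A'A iA.
rewrite -{2}(setDUK A'A) Rintegral_setU//.
- by rewrite addrAC subrr add0r.
- exact: measurableD.
- by rewrite setDUK.
- by apply/disj_setPS => x [A'x []].
Qed.

Lemma Rintegral_sum (D : set E) (I : Type) (s : seq I) (f : I -> E -> R) :
  measurable D -> (forall i, mu.-integrable D (EFin \o f i)) ->
  \int[mu]_(x in D) (\sum_(i <- s) f i x) = \sum_(i <- s) \int[mu]_(x in D) f i x.
Proof.
move=> mD fi; rewrite sum_fine; last by move=> i _; exact: integrable_fin_num (fi i).
rewrite -integral_sum// /Rintegral; congr fine; under [RHS]eq_integral do rewrite sumEFin.
by [].
Qed.

Lemma integrable_bounded_mul (f g : E -> R) (k : R) : measurable_fun setT f ->
  (forall x, `|f x| <= k) -> mu.-integrable setT (EFin \o g) ->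
  mu.-integrable setT (EFin \o (fun x => f x * g x)).
Proof.
move=> mf fk ig; have mg : measurable_fun setT g.
  by case/integrableP : ig => /measurable_EFinP.
apply: (@le_integrable _ _ _ _ _ _ _ (fun x => (k * g x)%:E)) => //.
- exact/measurable_EFinP/measurable_funM.
- move=> x _ /=; rewrite lee_fin !normrM ler_wpM2r// (le_trans (fk x))// ler_norm//.
- exact: (integrableZl measurableT k ig).
Qed.

End Rintegral_extra.

Lemma cvg_sum_seq (R : realType) (I : Type) (s : seq I) (f : I -> nat -> R)
    (l : I -> R) : (forall i, f i n @[n --> \oo] --> l i) ->
  \sum_(i <- s) f i n @[n --> \oo] --> \sum_(i <- s) l i.
Proof.
move=> fl; elim: s => [|i s IH].
  by under eq_fun do rewrite big_nil; rewrite big_nil; exact: cvg_cst.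
by under eq_fun do rewrite big_cons; rewrite big_cons; exact: cvgD.
Qed.

Section dominated_sets.
Context d (E : measurableType d) (R : realType).
Variables (mu : {measure set E -> \bar R}) (F : nat -> E -> R) (B : E -> R).
Hypothesis mF : forall n, measurable_fun setT (F n).
Hypothesis FB : forall n x, `|F n x| <= B x.
Hypothesis iB : mu.-integrable setT (EFin \o B).

Let B_ge0 x : 0 <= B x.
Proof. exact: le_trans (normr_ge0 _) (FB 0 x). Qed.

Let iF n : mu.-integrable setT (EFin \o F n).
Proof.
apply: le_integrable iB => //; first exact/measurable_EFinP.
by move=> x _ /=; rewrite lee_fin (le_trans (FB n x))// ler_norm.
Qed.

Let iFS n A : measurable A -> mu.-integrable A (EFin \o F n).
Proof. by move=> mA; exact: integrableS (iF n). Qed.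

Let iBS A : measurable A -> mu.-integrable A (EFin \o B).
Proof. by move=> mA; exact: integrableS iB. Qed.

(** The price of replacing [A] by [A'] is the mass of [B] on the difference, the same for all [n].
    This uniformity lets limits in the set and in [n] be exchanged. *)
Lemma Rintegral_setD_dominated n (A A' : set E) : measurable A -> measurable A' ->
  A' `<=` A ->
  `|\int[mu]_(x in A) F n x| <= `|\int[mu]_(x in A') F n x| +
    (\int[mu]_(x in A) B x - \int[mu]_(x in A') B x).
Proof.
move=> mA mA' A'A; have mD := measurableD mA mA'.
have -> : \int[mu]_(x in A) F n x =
    \int[mu]_(x in A') F n x + \int[mu]_(x in A `\` A') F n x.
  by rewrite Rintegral_setD ?iFS// addrC subrK.
rewrite (le_trans (ler_normD _ _))// lerD2l -Rintegral_setD ?iBS//.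
rewrite (le_trans (le_normr_Rintegral mD (iFS n mD)))//.
apply: le_Rintegral => //; last exact: iBS.
exact: integrable_norm (iFS n mD).
Qed.

Variable C : set (set E).
Hypothesis CI : setI_closed C.
Hypothesis mC : measurable = <<s C >>.
Hypothesis CT : C setT.
Hypothesis FC : forall A, C A -> \int[mu]_(x in A) F n x @[n --> \oo] --> (0:R).

Lemma dominated_cvg_sets A : measurable A ->
  \int[mu]_(x in A) F n x @[n --> \oo] --> (0:R).
Proof.
pose H := [set A | measurable A /\ \int[mu]_(x in A) F n x @[n --> \oo] --> (0:R)].
(* Pi-lambda theorem: [H] is closed under increasing unions because the mass of
   [B] on the missing part is small uniformly in [n]. *)
suff : <<s C >> `<=` H by rewrite -mC => /(_ A) + mA => /(_ mA)[].
apply: lambda_system_subset => //; last first.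
  by move=> X CX; split; [rewrite mC; exact: sub_sigma_algebra|exact: FC].
split => //.
- by split => //; exact: FC.
- move=> X Y YX [mX FX] [mY FY]; split; first exact: measurableD.
  under eq_fun do rewrite Rintegral_setD ?iFS//.
  by rewrite -[0]subr0; exact: cvgB.
- move=> G ndG HG; have mG i : measurable (G i) := (HG i).1.
  have mUG : measurable (\bigcup_i G i) by exact: bigcupT_measurable.
  split => //.
  have BG : \int[mu]_(x in G i) B x @[i --> \oo] --> \int[mu]_(x in \bigcup_i G i) B x.
    apply: fine_cvg.
    rewrite fineK; last exact: integrable_fin_num (iBS mUG).
    apply: ge0_nondecreasing_set_cvg_integral => //.
    + move=> i; apply/measurable_EFinP.
      by have /integrableP[/measurable_EFinP] := iBS (mG i).
    + by move=> i x _; rewrite lee_fin.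
  apply/cvgr0Pnorm_lt => e e0.
  have e20 : 0 < e / 2 by rewrite divr_gt0.
  have [k _ /(_ k (leqnn k))] : \forall k \near \oo,
      `|\int[mu]_(x in \bigcup_i G i) B x - \int[mu]_(x in G k) B x| < e / 2.
    by move/cvgrPdist_lt : BG; exact.
  move=> /= Bk.
  have /cvgr0Pnorm_lt/(_ _ e20) := (HG k).2.
  apply: filterS => n Fn.
  have GU : G k `<=` \bigcup_i G i by exact: bigcup_sup.
  rewrite (le_lt_trans (Rintegral_setD_dominated n mUG (mG k) GU))//.
  by rewrite [e]splitr ltrD// (le_lt_trans (ler_norm _))//.
Qed.

Import HBNNSimple.

(** A simple function is a finite combination of indicators of its level sets, so linearity reduces
    the claim to [dominated_cvg_sets]. *)
Let cvg_nnsfun (s : {nnsfun E >-> R}) :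
  \int[mu]_x (F n x * s x) @[n --> \oo] --> (0:R).
Proof.
have fin_s := @fimfunP _ _ s.
have iFs n y : mu.-integrable setT (EFin \o F n \_ (s @^-1` [set y])).
  apply: le_integrable (iF n) => //.
    apply/measurable_EFinP; apply/(measurable_restrict _ _ _).1 => //.
    by rewrite setTI; exact: measurable_funS (mF n).
  by move=> x _ /=; rewrite patchE; case: ifP => // _; rewrite normr0 lee_fin.
have -> : (fun n => \int[mu]_x (F n x * s x)) =
   (fun n => \sum_(y <- fset_set (range s)) y * \int[mu]_(x in s @^-1` [set y]) F n x).
  apply/funext => n.
  transitivity (\int[mu]_x (\sum_(y <- fset_set (range s))
       (y * (F n \_ (s @^-1` [set y])) x))).
    apply: eq_Rintegral => x _; rewrite (fimfunE s x) fsbig_finite//= mulr_sumr.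
    apply: eq_bigr => y _; rewrite mulrCA; congr (_ * _).
    rewrite indicE patchE; case: ifPn => _; rewrite ?mulr1 ?mulr0//.
  rewrite Rintegral_sum//; last first.
    by move=> y; exact: (integrableZl measurableT y (iFs n y)).
  apply: eq_bigr => y _; rewrite RintegralZl//.
  by rewrite -Rintegral_mkcond.
have := @cvg_sum_seq _ _ (fset_set (range s))
  (fun y n => y * \int[mu]_(x in s @^-1` [set y]) F n x) (fun=> 0).
rewrite big1//; apply=> y; rewrite -[X in _ --> X](mulr0 y).
by apply: cvgMl_tmp; apply: dominated_cvg_sets; exact: measurable_funPTI.
Qed.


(** Approximation from below by simple functions [s k]. The error is at most the integral of
    [B * (g - s k)], uniformly in [n], and tends to 0 by dominated convergence under [B * g]. *)
Let cvg_ge0 (g : E -> R) : measurable_fun setT g -> (forall x, 0 <= g x) ->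
  mu.-integrable setT (EFin \o (fun x => B x * g x)) ->
  \int[mu]_x (F n x * g x) @[n --> \oo] --> (0:R).
Proof.
move=> mg g0 iBg.
have mEg : measurable_fun setT (EFin \o g) by exact/measurable_EFinP.
pose s := nnsfun_approx measurableT mEg.
have sg k x : s k x <= g x.
  by rewrite -lee_fin nnsfun_approxE; apply: le_approx => // y _; rewrite lee_fin.
have s0 k x : 0 <= s k x by exact: fun_ge0.
have mB : measurable_fun setT B by case/integrableP : iB => /measurable_EFinP.
have iBs k : mu.-integrable setT (EFin \o (fun x => B x * s k x)).
  apply: le_integrable iBg => //; first exact/measurable_EFinP/measurable_funM.
  by move=> x _ /=; rewrite lee_fin !normrM ler_wpM2l// !ger0_norm.
have Bs : \int[mu]_x (B x * s k x) @[k --> \oo] --> \int[mu]_x (B x * g x).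
  apply: fine_cvg; rewrite fineK; last exact: integrable_fin_num.
  have h1 k : measurable_fun setT (fun x => (B x * s k x)%:E).
    exact/measurable_EFinP/measurable_funM.
  have h2 : measurable_fun setT (fun x => (B x * g x)%:E).
    exact/measurable_EFinP/measurable_funM.
  have h3 : {ae mu, forall x, setT x ->
      (fun k => (B x * s k x)%:E) @ \oo --> (B x * g x)%:E}.
    apply: aeW => x _; apply/fine_cvgP; split; first exact: nearW.
    apply: cvgM; first exact: cvg_cst.
    have g0E y : setT y -> (0 <= (EFin \o g) y)%E by rewrite lee_fin.
    by have /fine_cvgP[] := @cvg_nnsfun_approx _ _ _ _ measurableT _ mEg g0E x I.
  have h5 : {ae mu, forall x k, setT x -> (`|(B x * s k x)%:E| <= (B x * g x)%:E)%E}.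
    by apply: aeW => x k _; rewrite lee_fin normrM !ger0_norm// ler_wpM2l.
  by have [_ _] := dominated_convergence measurableT h1 h2 h3 iBg h5.
have iFg (f : E -> R) k : measurable_fun setT f -> (forall x, 0 <= f x <= g x) ->
    mu.-integrable setT (EFin \o (fun x => F k x * f x)).
  move=> mf fg; apply: le_integrable iBg => //.
    exact/measurable_EFinP/measurable_funM.
  move=> x _ /=; rewrite lee_fin !normrM ler_pM//.
    by rewrite (le_trans (FB k x))// ler_norm.
  by have /andP[f0 fgx] := fg x; rewrite !ger0_norm.
apply/cvgr0Pnorm_lt => e e0.
have e20 : 0 < e / 2 by rewrite divr_gt0.
have [k _ /(_ k (leqnn k))] : \forall k \near \oo,
    `|\int[mu]_x (B x * g x) - \int[mu]_x (B x * s k x)| < e / 2.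
  by move/cvgrPdist_lt : Bs; exact.
move=> /= Bk.
have /cvgr0Pnorm_lt/(_ _ e20) := cvg_nnsfun (s k).
apply: filterS => n Fn.
have sgx x : 0 <= s k x <= g x by rewrite s0 sg.
have ggx x : 0 <= g x <= g x by rewrite g0 lexx.
have msk : measurable_fun setT (s k) by [].
rewrite -[X in `|X|](subrK (\int[mu]_x (F n x * s k x))) (le_lt_trans (ler_normD _ _))//.
rewrite [e]splitr ltrD// (le_lt_trans _ Bk)//.
have iFgn := iFg g n mg ggx; have iFsn := iFg (s k) n msk sgx.
rewrite -RintegralB//.
have iFd : mu.-integrable setT (EFin \o (fun x => F n x * g x - F n x * s k x)).
  exact: (integrableB measurableT iFgn iFsn).
rewrite (le_trans _ (ler_norm _))// -RintegralB//.
rewrite (le_trans (le_normr_Rintegral measurableT iFd))//.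
apply: le_Rintegral => //.
- exact: integrable_norm iFd.
- exact: (integrableB measurableT iBg (iBs k)).
- move=> x _; rewrite -!mulrBr normrM (@ger0_norm _ (g x - _)) ?subr_ge0//.
  by rewrite ler_wpM2r// subr_ge0.
Qed.

(** The growth of [g] is controlled through [B * g], so [g] may be unbounded: an arbitrary [L^2]
    function when [B] is 1, a quotient by the rates when [B] is their sum. *)
Lemma dominated_weak_cvg (g : E -> R) : measurable_fun setT g ->
  mu.-integrable setT (EFin \o (fun x => B x * g x)) ->
  \int[mu]_x (F n x * g x) @[n --> \oo] --> (0:R).
Proof.
move=> mg iBg.
have mB : measurable_fun setT B by case/integrableP : iB => /measurable_EFinP.
(* The positive and the negative part of [g] both lie between 0 and its absolute value, so [main]
   serves for each. *)
have main (f : E -> R) : measurable_fun setT f -> (forall x, 0 <= f x <= `|g x|) ->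
    (forall n, mu.-integrable setT (EFin \o (fun x => F n x * f x))) /\
    \int[mu]_x (F n x * f x) @[n --> \oo] --> (0:R).
  move=> mf fg; have f0 x : 0 <= f x by case/andP : (fg x).
  have iBf : mu.-integrable setT (EFin \o (fun x => B x * f x)).
    apply: le_integrable iBg => //; first exact/measurable_EFinP/measurable_funM.
    move=> x _ /=; rewrite lee_fin !normrM ler_wpM2l// ger0_norm//.
    by case/andP : (fg x).
  split; last exact: cvg_ge0.
  move=> n; apply: le_integrable iBf => //; first exact/measurable_EFinP/measurable_funM.
  by move=> x _ /=; rewrite lee_fin !normrM ler_wpM2r// (le_trans (FB n x))// ler_norm.
have [|i1 c1] := main (fun x => Num.max (g x) 0) (measurable_maxr mg (measurable_cst _)).
  by move=> x; rewrite le_max lexx orbT/= ge_max ler_norm normr_ge0.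
have [| |i2 c2] := main (fun x => Num.max (- g x) 0).
  by apply: measurable_maxr => //; exact: measurable_funN.
  by move=> x; rewrite le_max lexx orbT/= ge_max -normrN ler_norm normr_ge0.
rewrite (_ : (fun n => _) = (fun n => \int[mu]_x (F n x * Num.max (g x) 0) -
    \int[mu]_x (F n x * Num.max (- g x) 0))).
  by rewrite -[X in _ --> X]subr0; exact: cvgB.
apply/funext => n; rewrite -RintegralB//; apply: eq_Rintegral => x _.
by rewrite -mulrBr; congr (_ * _); rewrite /Num.max; do 2 case: ifPn; lra.
Qed.

End dominated_sets.

(** * Restricted and product measures *)

Section integral_mrestr.
Context d (E : measurableType d) (R : realType) (mu : {measure set E -> \bar R}).
Variables (D : set E) (mD : measurable D).
Local Open Scope ereal_scope.

(** The complement of [D] is null for the restricted measure, and on subsets of [D] the two measures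
    agree. *)
Lemma ge0_integral_mrestr (A : set E) (f : E -> \bar R) : measurable A ->
  measurable_fun A f -> (forall x, 0 <= f x) ->
  \int[mrestr mu mD]_(x in A) f x = \int[mu]_(x in A `&` D) f x.
Proof.
move=> mA mf f0; rewrite (@ge0_negligible_integral _ _ _ _ A (~` D))//.
- rewrite setDE setCK; apply: eq_measure_integral => /= B mB BAD.
  by rewrite /mrestr setIidl// => x /BAD[].
- exact: measurableC.
- by rewrite /= /mrestr setICl measure0.
Qed.

Lemma integral_mrestr (A : set E) (f : E -> \bar R) : measurable A ->
  measurable_fun A f ->
  \int[mrestr mu mD]_(x in A) f x = \int[mu]_(x in A `&` D) f x.
Proof.
move=> mA mf; rewrite [LHS]integralE [RHS]integralE; congr (_ - _).
  by apply: ge0_integral_mrestr => //; exact: measurable_funepos.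
by apply: ge0_integral_mrestr => //; exact: measurable_funeneg.
Qed.

Lemma integrable_mrestr (A : set E) (f : E -> \bar R) : measurable A ->
  measurable_fun A f -> mu.-integrable (A `&` D) f ->
  (mrestr mu mD).-integrable A f.
Proof.
move=> mA mf /integrableP[_ fi]; apply/integrableP; split => //.
by rewrite ge0_integral_mrestr//; exact: measurableT_comp.
Qed.

Lemma ae_mrestr (P : set E) : {ae mu, forall x, D x -> P x} ->
  {ae mrestr mu mD, forall x, P x}.
Proof.
move=> [N [mN N0 PN]]; exists (N `|` ~` D); split.
- exact: measurableU (measurableC mD).
- apply/eqP; rewrite eq_le measure_ge0 andbT -N0 /= /mrestr setIUl setICl setU0.
  by apply: le_measure; try apply: mem_set => //; [exact: measurableI|exact: subIsetl].
- move=> x /= nPx; have [Dx|] := pselect (D x); last by right.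
  by left; apply: PN => /= /(_ Dx).
Qed.

End integral_mrestr.

Section tensor.
Context d1 d2 (T1 : measurableType d1) (T2 : measurableType d2) (R : realType).
Variables (m1 : {sigma_finite_measure set T1 -> \bar R}).
Variables (m2 : {sigma_finite_measure set T2 -> \bar R}).
Local Open Scope ereal_scope.

Let tensorE (Q : set T1) (E : set T2) (g : T2 -> R) p :
  (EFin \o (g \o snd)) \_ (Q `*` E) p = (\1_Q p.1 * (g \_ E) p.2)%:E :> \bar R.
Proof.
rewrite /= indicE !patchE in_setX; case: (p.1 \in Q) => /=; last by rewrite mul0r.
by rewrite mul1r; case: ifP.
Qed.

(** Extended by zero, the integrand is a function of the first variable times one of the second, so
    Tonelli's theorem factors the integral of its absolute value. *)
Lemma integrable_tensor (Q : set T1) (E : set T2) (g : T2 -> R) :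
  measurable Q -> m1 Q < +oo -> measurable E -> m2.-integrable E (EFin \o g) ->
  (m1 \x m2).-integrable (Q `*` E) (EFin \o (g \o snd)).
Proof.
move=> mQ Qoo mE ig; have mQE := measurableX mQ mE.
apply/(integrable_mkcond _ mQE); rewrite (funext (tensorE Q E g)).
have /integrableP[mg gi] : m2.-integrable setT (EFin \o (g \_ E)).
  by rewrite -restrict_EFin; apply/(integrable_mkcond _ mE).
have mgE : measurable_fun setT (g \_ E) by exact/measurable_EFinP.
apply/integrable12ltyP.
  apply/measurable_EFinP/measurable_funM; first exact: measurableT_comp.
  exact: measurableT_comp.
rewrite (eq_integral (fun x => (\1_Q x)%:E * \int[m2]_y `|((g \_ E) y)%:E|)).
  rewrite ge0_integralZr//.
  - rewrite integral_indic// setIT; apply: lte_mul_pinfty => //.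
    by rewrite ge0_fin_numE.
  - exact/measurable_EFinP.
  - exact: integral_ge0.
move=> x _; rewrite -ge0_integralZl//.
- by apply: eq_integral => y _; rewrite /= normrM EFinM ger0_norm.
- by apply: measurableT_comp => //.
Qed.

Lemma Rintegral_tensor (Q : set T1) (E : set T2) (g : T2 -> R) :
  measurable Q -> m1 Q < +oo -> measurable E -> m2.-integrable E (EFin \o g) ->
  (\int[m1 \x m2]_(p in Q `*` E) g p.2 = fine (m1 Q) * \int[m2]_(t in E) g t)%R.
Proof.
move=> mQ Qoo mE ig; have mQE := measurableX mQ mE.
have igT : m2.-integrable setT (EFin \o (g \_ E)).
  by rewrite -restrict_EFin; apply/(integrable_mkcond _ mE).
have := integrable_tensor mQ Qoo mE ig.
move/(integrable_mkcond _ mQE) => iQE.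
rewrite {1}/Rintegral integral_mkcond -integral12_prod_meas1//.
rewrite (eq_integral (fun x => (\1_Q x)%:E * \int[m2]_y (((g \_ E) y)%:E))); last first.
  move=> x _; rewrite /fubini_F; under eq_integral do rewrite tensorE/= EFinM.
  by rewrite integralZl.
have fi := integrable_fin_num measurableT igT.
rewrite -(fineK fi) integralZr//; last first.
  apply/integrableP; split; first exact/measurable_EFinP.
  rewrite (eq_integral (fun x => (\1_Q x)%:E)) ?integral_indic ?setIT//.
  by move=> x _; rewrite gee0_abs ?lee_fin.
rewrite integral_indic// setIT fineM//; last by rewrite ge0_fin_numE.
rewrite fineK// /Rintegral [in RHS]integral_mkcond; congr (_ * fine _)%R.
by apply: eq_integral => y _; rewrite -restrict_EFin.
Qed.

End tensor.

(** * Integrals of step functions *)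

Section steps.
Context {R : realType}.
Implicit Types (T : R) (n : nat).

Lemma sigma_finite_lebesgue2 : sigma_finite setT (@lebesgue2 R).
Proof.
exists (fun n => `[- n%:R, n%:R] `*` `[- n%:R, n%:R]).
  apply/esym/seteqP; split => // -[x y] _.
  exists (Num.truncn (Num.max `|x| `|y|)).+1 => //=.
  have := truncnS_gt (Num.max `|x| `|y|); set k := _.+1 => /ltW.
  by rewrite ge_max !in_itv/= -!ler_norml => /andP.
move=> n; have mI : measurable (`[- n%:R, n%:R] : set (BR R)) by exact: measurable_itv.
split; first exact: measurableX.
have Ioo : (@lebesgue_measure R `[(- n%:R)%R, n%:R%R] < +oo)%E.
  by rewrite lebesgue_measure_itv/=; case: ifP => // _; rewrite -EFinD ltry.
rewrite /lebesgue2/= product_measure1E//; apply: lte_mul_pinfty => //.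
by rewrite ge0_fin_numE.
Qed.

(* [lebesgue2] is only declared as a measure, whereas Fubini needs a sigma-finite
   structure. *)
Definition lebesgue2_fun : set (BR R * BR R) -> \bar R := @lebesgue2 R.
HB.instance Definition _ := Measure.copy lebesgue2_fun (@lebesgue2 R).
HB.instance Definition _ := Measure_isSigmaFinite.Build _ _ _ lebesgue2_fun
  sigma_finite_lebesgue2.

Lemma measurable_cell n (i : 'I_n) : measurable (cell i : set (BR R)).
Proof. by rewrite /cell; case: ifP => _; exact: measurable_itv. Qed.

Lemma lebesgue_measure_cell n (i : 'I_n) :
  @lebesgue_measure R (cell i) = (n%:R^-1)%:E.
Proof.
have n0 : 0 < n%:R^-1 :> R by rewrite invr_gt0 ltr0n (leq_ltn_trans _ (ltn_ord i)).
rewrite /cell; case: ifPn => _; rewrite lebesgue_measure_itv/= lte_fin.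
  by rewrite n0 oppr0 adde0.
rewrite ltr_pM2r// ltr_nat ltnSn -EFinD -mulrBl; congr EFin.
by rewrite -natrB// subSnn mul1r.
Qed.

(** The factors [[0, 1]] account for the restriction built into [lebesgue_cube]. *)
Definition cell_part n (A1 A2 : set (BR R)) (i j : 'I_n) : set (BR R * BR R) :=
  (A1 `&` `[0, 1] `&` cell i) `*` (A2 `&` `[0, 1] `&` cell j).

Definition cell_weight n (A1 A2 : set (BR R)) (i j : 'I_n) : R :=
  fine (lebesgue2 (cell_part A1 A2 i j)).

Lemma measurable_cell_part n (A1 A2 : set (BR R)) (i j : 'I_n) :
  measurable A1 -> measurable A2 -> measurable (cell_part A1 A2 i j).
Proof.
move=> mA1 mA2; apply: measurableX; (apply: measurableI; last exact: measurable_cell);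
  by apply: measurableI => //; exact: measurable_itv.
Qed.

Lemma lebesgue2_cell_part n (A1 A2 : set (BR R)) (i j : 'I_n) :
  measurable A1 -> measurable A2 ->
  (lebesgue2 (cell_part A1 A2 i j) <= (n%:R^-1 * n%:R^-1)%:E)%E.
Proof.
move=> mA1 mA2.
have -> : (n%:R^-1 * n%:R^-1)%:E = lebesgue2 (cell i `*` cell j) :> \bar R.
  rewrite /lebesgue2/= product_measure1E; [|exact: measurable_cell..].
  by rewrite EFinM; congr (_ * _)%E; apply/esym; exact: lebesgue_measure_cell.
apply: le_measure; try apply: mem_set.
- exact: measurable_cell_part.
- by apply: measurableX; exact: measurable_cell.
- by move=> [x y] [[_ ?] [_ ?]].
Qed.

Lemma cell_weight_ge0 n (A1 A2 : set (BR R)) (i j : 'I_n) : 0 <= cell_weight A1 A2 i j.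
Proof. exact: fine_ge0. Qed.

(** Squared and summed over the [n^2] cells, this bound still leaves a summable [n^-2]. *)
Lemma cell_weight_le n (A1 A2 : set (BR R)) (i j : 'I_n) :
  measurable A1 -> measurable A2 -> cell_weight A1 A2 i j <= n%:R^-1 * n%:R^-1.
Proof.
move=> mA1 mA2; have cp := lebesgue2_cell_part i j mA1 mA2.
rewrite -lee_fin fineK// ge0_fin_numE//.
by rewrite (le_lt_trans cp)// ltry.
Qed.

Lemma measurable_indic_cells n (i j : 'I_n) :
  measurable_fun setT (fun p : BR R * BR R * BR R => \1_(cell i `*` cell j) p.1 : R).
Proof.
have mcc : measurable (cell i `*` cell j : set (BR R * BR R)).
  by apply: measurableX; exact: measurable_cell.
have mi : measurable_fun setT (\1_(cell i `*` cell j) : BR R * BR R -> R).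
  exact: measurable_indic.
exact: (measurableT_comp mi (@measurable_fst _ _ _ (BR R))).
Qed.

Lemma measurable_comp_snd (g : R -> R) : measurable_fun setT g ->
  measurable_fun setT (fun p : BR R * BR R * BR R => g p.2).
Proof. by move=> mg; exact: measurableT_comp. Qed.

Lemma cell_term T n (A1 A2 A3 : set (BR R)) (i j : 'I_n) (g : R -> R) :
  measurable A1 -> measurable A2 -> measurable A3 ->
  measurable_fun setT g ->
  (@lebesgue_measure R).-integrable `[0, T] (EFin \o g) ->
  (lebesgue_cube T).-integrable (A1 `*` A2 `*` A3)
     (fun p => (g p.2 * \1_(cell i `*` cell j) p.1)%:E) /\
  \int[lebesgue_cube T]_(p in A1 `*` A2 `*` A3) (g p.2 * \1_(cell i `*` cell j) p.1) =
  cell_weight A1 A2 i j * \int[@lebesgue_measure R]_(t in A3 `&` `[0, T]) g t.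
Proof.
move=> mA1 mA2 mA3 mg ig.
have mbox : measurable (A1 `*` A2 `*` A3) by do ?apply: measurableX.
have mcc : measurable (cell i `*` cell j : set (BR R * BR R)).
  by apply: measurableX; exact: measurable_cell.
have mccT := measurableX mcc (@measurableT _ (BR R)).
have mQ : measurable (cell_part A1 A2 i j) by exact: measurable_cell_part.
have Qoo : (lebesgue2 (cell_part A1 A2 i j) < +oo)%E.
  by rewrite (le_lt_trans (lebesgue2_cell_part i j mA1 mA2))// ltry.
have mE : measurable (A3 `&` `[0, T] : set (BR R)).
  by apply: measurableI => //; exact: measurable_itv.
have igE : (@lebesgue_measure R).-integrable (A3 `&` `[0, T]) (EFin \o g).
  apply: integrableS ig => //; exact: measurable_itv.
have mf : measurable_fun (A1 `*` A2 `*` A3 : set (BR R * BR R * BR R))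
    (fun p => (g p.2 * \1_(cell i `*` cell j) p.1)%:E).
  apply/measurable_EFinP; apply: measurable_funS (measurableT) _ _ => //.
  apply: measurable_funM; first exact: measurableT_comp.
  exact: measurable_indic_cells.
(* Cell, box and cube constrain space and time separately, so the domain is a product and the tensor
   formula applies. *)
have setE : A1 `*` A2 `*` A3 `&` cube T `&` (cell i `*` cell j `*` setT) =
    cell_part A1 A2 i j `*` (A3 `&` `[0, T]).
  by apply/seteqP; split => [[[x y] t]|[[x y] t]] /=;
    rewrite /cube /unit_square/= /cell_part/=; tauto.
have fE (p : BR R * BR R * BR R) : (g p.2 * \1_(cell i `*` cell j) p.1)%:E =
    ((EFin \o (g \o snd)) \_ (cell i `*` cell j `*` setT)) p.
  rewrite patchE indicE (_ : (p \in _) = (p.1 \in cell i `*` cell j)); last first.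
    by apply/idP/idP => /set_mem h; apply/mem_set; [exact: h.1|split].
  by case: ifPn => _ /=; rewrite ?mulr1 ?mulr0.
have mcube := measurable_cube T; have mboxT := measurableI _ _ mbox mcube.
split.
  apply: integrable_mrestr => //; rewrite (funext fE).
  apply/(integrable_restrict _ mccT mboxT); rewrite setE.
  exact: (@integrable_tensor _ _ _ _ R lebesgue2_fun
    (@lebesgue_measure R) _ _ _ mQ Qoo mE igE).
rewrite /Rintegral integral_mrestr// (eq_integral _ _ (fun p _ => fE p)).
rewrite -integral_mkcondr setE.
exact: (@Rintegral_tensor _ _ _ _ R lebesgue2_fun
  (@lebesgue_measure R) _ _ _ mQ Qoo mE igE).
Qed.

Lemma measurable_step n (f : 'I_n -> 'I_n -> R -> R) :
  (forall i j, measurable_fun setT (f i j)) ->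
  measurable_fun setT (step f : BR R * BR R * BR R -> R).
Proof.
move=> mf; apply: measurable_sum => i; apply: measurable_sum => j.
apply: measurable_funM; first exact: (@measurable_comp_snd (f i j)).
exact: measurable_indic_cells.
Qed.

(** Separates space from randomness: when the entries are random paths, the weights are
    deterministic and only the time integrals are random. *)
Lemma Rintegral_step T n (A1 A2 A3 : set (BR R)) (f : 'I_n -> 'I_n -> R -> R) :
  measurable A1 -> measurable A2 -> measurable A3 ->
  (forall i j, measurable_fun setT (f i j)) ->
  (forall i j, (@lebesgue_measure R).-integrable `[0, T] (EFin \o f i j)) ->
  \int[lebesgue_cube T]_(p in A1 `*` A2 `*` A3) step f p =
  \sum_(i < n) \sum_(j < n) cell_weight A1 A2 i j *
    \int[@lebesgue_measure R]_(t in A3 `&` `[0, T]) f i j t.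
Proof.
move=> mA1 mA2 mA3 mf fi.
have mbox : measurable (A1 `*` A2 `*` A3) by do ?apply: measurableX.
have ct i j := @cell_term T n A1 A2 A3 i j (f i j) mA1 mA2 mA3 (mf i j) (fi i j).
rewrite /step Rintegral_sum//; last first.
  move=> i; rewrite (_ : EFin \o _ = fun p => \sum_(j <- index_enum 'I_n)
      (f i j p.2 * \1_(cell i `*` cell j) p.1)%:E)%E; last first.
    by apply/funext => p /=; rewrite -sumEFin.
  by apply: integrable_sum => // j _; exact: (ct i j).1.
apply: eq_bigr => i _; rewrite Rintegral_sum//.
  by apply: eq_bigr => j _; exact: (ct i j).2.
by move=> j; exact: (ct i j).1.
Qed.

End steps.

(** * Processes and time integrals *)

Section clamp.
Context {R : realType} (T : R).
Hypothesis T_ge0 : 0 <= T.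

(* Paths are only constrained on [0, T]; [clamp] extends them by constants. *)
Definition clamp (t : R) : R := Num.min (Num.max 0 t) T.

Lemma clamp_itv t : 0 <= clamp t <= T.
Proof. by rewrite /clamp ge_min lexx orbT andbT le_min le_max lexx T_ge0. Qed.

Lemma clamp_id t : 0 <= t <= T -> clamp t = t.
Proof. by move=> /andP[t0 tT]; rewrite /clamp max_r// min_l. Qed.

Lemma measurable_clamp : measurable_fun setT clamp.
Proof. by apply: measurable_minr => //; exact: measurable_maxr. Qed.

(** Index of the mesh interval of width [1 / (m + 1)] that contains [clamp t]. *)
Definition grid (m : nat) (t : R) : nat := Num.truncn (m.+1%:R * clamp t).

Lemma measurable_grid (m k : nat) : measurable [set t | grid m t = k].
Proof.
have -> : [set t | grid m t = k] =
    (fun t => m.+1%:R * clamp t) @^-1` `[k%:R, k.+1%:R[%classic.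
  apply/seteqP; split => t; rewrite /grid/= in_itv/=.
    by move=> <-; apply: truncn_itv; rewrite mulr_ge0//; case/andP: (clamp_itv t).
  by move=> /truncn_def.
rewrite -[_ @^-1` _]setTI; apply: measurable_funM => //.
exact: measurable_clamp.
Qed.

(* Strictly to the right of [t] (or equal to [T]), so that right-continuity gives
   convergence along the grids. *)
Definition grid_next (m k : nat) : R := clamp (k.+1%:R / m.+1%:R).

Lemma grid_next_right (m : nat) t : clamp t < T ->
  clamp t < grid_next m (grid m t) <= clamp t + m.+1%:R^-1.
Proof.
move=> tT; have /andP[t0 _] := clamp_itv t.
have m0 : 0 < m.+1%:R :> R by [].
have /andP[g1 g2] : (grid m t)%:R <= m.+1%:R * clamp t < (grid m t).+1%:R.
  by apply: truncn_itv; rewrite mulr_ge0.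
have h1 : clamp t < (grid m t).+1%:R / m.+1%:R by rewrite ltr_pdivlMr// mulrC.
have h2 : (grid m t).+1%:R / m.+1%:R <= clamp t + m.+1%:R^-1.
  by rewrite ler_pdivrMr// mulrDl mulVf ?lt0r_neq0// -natr1 lerD2r mulrC.
rewrite /grid_next {2 3}/clamp lt_min tT andbT lt_max h1 orbT/=.
by rewrite ge_min ge_max h2 andbT addr_ge0// invr_ge0.
Qed.

Lemma grid_next_end (m : nat) t : clamp t = T -> grid_next m (grid m t) = T.
Proof.
move=> tT; have m0 : 0 < m.+1%:R :> R by [].
have /andP[g1 g2] : (grid m t)%:R <= m.+1%:R * clamp t < (grid m t).+1%:R.
  by apply: truncn_itv; rewrite mulr_ge0// tT.
rewrite /grid_next {1}/clamp min_r// le_max; apply/orP; right.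
by rewrite ler_pdivlMr// mulrC -tT ltW.
Qed.

End clamp.

Section cadlag_process.
Context {R : realType} (T : R) {d : measure_display} {Omega : measurableType d}.
Hypothesis T_ge0 : 0 <= T.
Variable X : R -> Omega -> bool.
Hypothesis mX : forall t, measurable_fun setT (X t).
Hypothesis cX : forall omega, cadlag T (X ^~ omega).

(** Joint measurability: the process is a pointwise limit of processes constant in time on each mesh
    interval. As [bool] is discrete, right-continuity makes the values agree from some mesh on. *)
Lemma measurable_process :
  measurable_fun setT (fun p : BR R * Omega => (X (clamp T p.1) p.2)%:R : R).
Proof.
pose h m (p : BR R * Omega) : R := (X (grid_next T m (grid T m p.1)) p.2)%:R.
apply: (@measurable_fun_cvg _ _ _ _ h).
- move=> m _ Y mY; rewrite setTI.
  have -> : h m @^-1` Y = \bigcup_k ([set t | grid T m t = k] `*`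
      [set w | Y (X (grid_next T m k) w)%:R]).
    apply/seteqP; split => [[t w] /= hY|[t w] [k _ [/= <-]]//].
    by exists (grid T m t).
  apply: bigcupT_measurable => k; apply: measurableX; first exact: measurable_grid.
  have := mX (grid_next T m k) measurableT (Y := [set b : bool | Y b%:R]) I.
  by rewrite setTI.
- move=> [t w] _; rewrite /h/=.
  have /andP[t0 tT] := clamp_itv T_ge0 t.
  (* Right-continuity says nothing at [T]; there the next grid point is [T] itself. *)
  have [tTE|tTN] := eqVneq (clamp T t) T.
    apply: cvg_near_cst; apply: nearW => m.
    by rewrite (grid_next_end T_ge0) // tTE.
  have tT' : clamp T t < T by rewrite lt_neqAle tTN.
  have [cr _] := cX w; have clampT : 0 <= clamp T t < T by rewrite t0.
  have /discrete_cvg [e /= e0 he] := cr _ clampT.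
  apply: cvg_near_cst.
  have [N _ hN] : \forall m \near \oo, m.+1%:R^-1 < e :> R.
    exact: near_infty_natSinv_lt (PosNum e0).
  exists N => // m /hN/= me.
  have /andP[r1 r2] := grid_next_right T_ge0 m tT'.
  suff -> : X (grid_next T m (grid T m t)) w = X (clamp T t) w by [].
  apply: he => //=.
  by rewrite distrC ger0_norm ?subr_ge0 ?ltW// ltrBlDl (le_lt_trans r2)// ltrD2l.
Qed.

End cadlag_process.

Section time_integral.
Context {R : realType} {d : measure_display} {Omega : measurableType d}.
Variables (P : probability Omega R) (Z : BR R * Omega -> R) (k : R) (E : set (BR R)).
Local Notation lam := (@lebesgue_measure R).
Hypothesis mZ : measurable_fun setT Z.
Hypothesis Zk : forall p, `|Z p| <= k.
Hypothesis mE : measurable E.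
Hypothesis Efin : (lam E < +oo)%E.

Let mZ1 w : measurable_fun setT (fun t : BR R => Z (t, w)).
Proof. exact: measurableT_comp. Qed.

Let mZ2 t : measurable_fun setT (fun w : Omega => Z (t, w)).
Proof. exact: measurableT_comp. Qed.

Let bounded_section w : [bounded Z (t, w) | t in E].
Proof. by exists k; split; [exact: num_real|move=> y ky t _; exact/(le_trans (Zk _))/ltW]. Qed.

Lemma integrable_section w : lam.-integrable E (fun t => (Z (t, w))%:E).
Proof.
apply: measurable_bounded_integrable => //.
exact: measurable_funS (mZ1 w).
Qed.

Lemma time_integral_le w : `|\int[lam]_(t in E) Z (t, w)| <= k * fine (lam E).
Proof.
have iZ := integrable_section w.
rewrite (le_trans (le_normr_Rintegral mE iZ))// -(Rintegral_cst lam mE).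
apply: le_Rintegral => //.
- exact: integrable_norm iZ.
- apply: measurable_bounded_integrable => //; exists k; split; first exact: num_real.
  move=> y /ltW ky t _; apply: le_trans ky; rewrite ger0_norm//.
  exact: le_trans (normr_ge0 _) (Zk (0, w)).
Qed.

(** The time window [E] enters as an indicator, so that Fubini's theorem is applied on the whole
    product space. *)
Let weighted (G : Omega -> R) (p : BR R * Omega) : \bar R :=
  (G p.2 * (Z p * \1_E p.1))%:E.

Let measurable_weighted (G : Omega -> R) : measurable_fun setT G ->
  measurable_fun setT (weighted G).
Proof.
move=> mG; apply/measurable_EFinP; apply: measurable_funM.
  exact: (measurableT_comp mG measurable_snd).
apply: measurable_funM => //.
have mi : measurable_fun setT (\1_E : BR R -> R) by exact: measurable_indic.
exact: (measurableT_comp mi measurable_fst).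
Qed.

Let integrable_weighted (G : Omega -> R) (K : R) : measurable_fun setT G ->
  (forall w, `|G w| <= K) -> (lam \x P)%E.-integrable setT (weighted G).
Proof.
move=> mG GK; have mW := measurable_weighted mG.
apply/integrable12ltyP => //.
apply: (@le_lt_trans _ _ (\int[lam]_t ((K * k)%:E * (\1_E t)%:E))%E).
  apply: ge0_le_integral => //.
  - by move=> t _; exact: integral_ge0.
  - have mA : measurable_fun setT (abse \o weighted G) by exact: measurableT_comp.
    exact: (measurable_fun_fubini_tonelli_F (abse \o weighted G) mA (fun=> abse_ge0 _)).
  - apply: measurable_funeM; apply/measurable_EFinP.
    exact: measurable_indic.
  move=> t _; rewrite -EFinM -[leRHS]mule1 -(@probability_setT _ _ _ P) -integral_cst//.
  apply: ge0_le_integral => //.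
  - apply: measurableT_comp => //; apply: (measurableT_comp mW).
    exact: measurable_pair1.
  - move=> w _; rewrite lee_fin !normrM mulrA (@ger0_norm _ (\1_E t))// ler_wpM2r//.
    by rewrite ler_pM.
have Kk0 : (0 <= (K * k)%:E)%E.
  by rewrite lee_fin mulr_ge0//;
  [exact: le_trans (normr_ge0 _) (GK point)|exact: le_trans (normr_ge0 _) (Zk point)].
have mi : measurable_fun setT (fun t : BR R => (\1_E t)%:E : \bar R).
  by apply/measurable_EFinP; exact: measurable_indic.
rewrite ge0_integralZl//.
by rewrite integral_indic// setIT; exact: lte_mul_pinfty.
Qed.

Let weighted_time_integral G w :
  (\int[lam]_t weighted G (t, w))%E = (G w * \int[lam]_(t in E) Z (t, w))%:E.
Proof.
have iZ := integrable_section w.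
rewrite EFinM /Rintegral fineK; last exact: integrable_fin_num.
rewrite -integralZl// [RHS]integral_mkcond; apply: eq_integral => t _.
by rewrite /weighted patchE indicE; case: ifP; rewrite ?mulr1 ?mulr0.
Qed.

Lemma measurable_time_integral :
  measurable_fun setT (fun w => \int[lam]_(t in E) Z (t, w)).
Proof.
have iW := @integrable_weighted (cst 1) 1 (measurable_cst _)
  (fun=> eq_ind_r (fun x => x <= 1) (lexx 1) (normr1 R)).
have := measurable_fubini_G iW.
rewrite (_ : fubini_G _ _ = EFin \o (fun w => \int[lam]_(t in E) Z (t, w))).
  by move/measurable_EFinP.
by apply/funext => w; rewrite /fubini_G weighted_time_integral mul1r.
Qed.

(** Fubini's theorem exchanges expectation and time integral. Used once per factor, this turns
    orthogonality at all pairs of times into orthogonality of time integrals. *)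
Lemma orthogonal_time_integral (G : Omega -> R) (K : R) : measurable_fun setT G ->
  (forall w, `|G w| <= K) ->
  (forall t, E t -> \int[P]_w (G w * Z (t, w)) = 0) ->
  \int[P]_w (G w * \int[lam]_(t in E) Z (t, w)) = 0.
Proof.
move=> mG GK GZ; have iW := integrable_weighted mG GK.
rewrite /Rintegral; under eq_integral do rewrite -weighted_time_integral.
rewrite -(Fubini iW) integral0_eq// => t _.
have [Et|nEt] := pselect (E t); last first.
  rewrite integral0_eq// => w _; rewrite /weighted indicE/= memNset// !mulr0//.
have iGZ : P.-integrable setT (EFin \o (fun w => G w * Z (t, w))).
  have PT : (P setT < +oo)%E by rewrite probability_setT ltry.
  apply: measurable_bounded_integrable => //.
  - exact: measurable_funM mG (mZ2 t).
  - exists (K * k); split; first exact: num_real.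
    by move=> y /ltW Ky w _; apply: le_trans Ky; rewrite normrM ler_pM.
have := GZ t Et; rewrite /Rintegral.
under [X in _ -> X = _]eq_integral.
  by move=> w _; rewrite /weighted indicE/= mem_set// mulr1; over.
by move=> e; rewrite -[LHS]fineK ?e//; exact: integrable_fin_num iGZ.
Qed.

End time_integral.

(** * Second moments *)

(** Telescoping: [(m + 1)^-2 <= m^-1 - (m + 1)^-1] for positive [m]. The term at 0 vanishes because
    [0^-1 = 0]. *)
Lemma sum_sqr_inv_le (R : realType) (N : nat) :
  \sum_(0 <= n < N) (n%:R^-1 * n%:R^-1) <= 2 :> R.
Proof.
suff h M : \sum_(0 <= n < M.+2) (n%:R^-1 * n%:R^-1) <= 2 - M.+1%:R^-1 :> R.
  case: N => [|[|M]]; first by rewrite big_geq.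
    by rewrite big_nat1 invr0 mul0r.
  by rewrite (le_trans (h M))// lerBlDl lerDr invr_ge0.
elim: M => [|M IH].
  by rewrite !big_nat_recr//= big_geq// invr0 mul0r !add0r invr1 mulr1; lra.
rewrite big_nat_recr//=.
apply: (@le_trans _ _ (2 - M.+1%:R^-1 + M.+2%:R^-1 * M.+2%:R^-1)).
  by rewrite lerD2r.
set x : R := M.+1%:R; have x0 : 0 < x by [].
have -> : M.+2%:R = x + 1 :> R by rewrite /x -natr1.
rewrite -subr_ge0.
have -> : 2 - (x + 1)^-1 - (2 - x^-1 + (x + 1)^-1 * (x + 1)^-1) =
   x^-1 * (x + 1)^-1 * (x + 1)^-1 by field; rewrite !lt0r_neq0// addr_gt0.
by rewrite !mulr_ge0// invr_ge0 ltW// addr_gt0.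
Qed.

Section square_summable.
Context {R : realType} {d : measure_display} {Omega : measurableType d}.
Variable P : probability Omega R.

Lemma integrable_bounded (Y : Omega -> R) (K : R) : measurable_fun setT Y ->
  (forall w, `|Y w| <= K) -> P.-integrable setT (EFin \o Y).
Proof.
move=> mY YK; have PT : (P setT < +oo)%E by rewrite probability_setT ltry.
apply: measurable_bounded_integrable => //; exists K; split; first exact: num_real.
by move=> y /ltW Ky w _; apply: le_trans Ky.
Qed.

Lemma Rintegral_cst_prob (K : R) : \int[P]_w K = K.
Proof.
transitivity (K * fine (P setT)); first exact: Rintegral_cst.
by rewrite probability_setT mulr1.
Qed.

Lemma le_Rintegral_cst (Y : Omega -> R) (K : R) : measurable_fun setT Y ->
  (forall w, `|Y w| <= K) -> \int[P]_w Y w <= K.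
Proof.
move=> mY YK; rewrite -[leRHS]Rintegral_cst_prob; apply: le_Rintegral => //.
- exact: integrable_bounded YK.
- by apply: (@integrable_bounded _ `|K|).
- by move=> w _; rewrite (le_trans (ler_norm _)).
Qed.

(** Orthogonality kills the off-diagonal terms of the expanded square, leaving [#|I|] terms instead
    of [#|I|^2]. *)
Lemma second_moment_orthogonal (I : finType) (c : I -> R) (Y : I -> Omega -> R) (C K : R) :
  (forall i, measurable_fun setT (Y i)) -> (forall i w, `|Y i w| <= K) ->
  (forall i j, i != j -> \int[P]_w (Y i w * Y j w) = 0) ->
  (forall i, 0 <= c i <= C) ->
  \int[P]_w ((\sum_i c i * Y i w) ^+ 2) <= #|I|%:R * (C ^+ 2 * K ^+ 2).
Proof.
move=> mY YK Y0 cC.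
have K0 (i : I) : 0 <= K by exact: le_trans (normr_ge0 (Y i point)) (YK i point).
have mYY i j : measurable_fun setT (fun w => Y i w * Y j w) by exact: measurable_funM.
have YYK i j w : `|Y i w * Y j w| <= K ^+ 2 by rewrite normrM expr2 ler_pM.
have iYY i j : P.-integrable setT (EFin \o (fun w => Y i w * Y j w)).
  exact: integrable_bounded (YYK i j).
have iT i j : P.-integrable setT (EFin \o (fun w => (c i * c j) * (Y i w * Y j w))).
  exact: (integrableZl measurableT (c i * c j) (iYY i j)).
have -> : \int[P]_w ((\sum_i c i * Y i w) ^+ 2) =
    \int[P]_w (\sum_i \sum_j (c i * c j) * (Y i w * Y j w)).
  apply: eq_Rintegral => w _; rewrite expr2 mulr_suml; apply: eq_bigr => i _.
  by rewrite mulr_sumr; apply: eq_bigr => j _; rewrite mulrACA.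
rewrite Rintegral_sum//; last first.
  move=> i; rewrite (_ : EFin \o _ = fun w => \sum_(j <- index_enum I)
      ((c i * c j) * (Y i w * Y j w))%:E)%E; last first.
    by apply/funext => w /=; rewrite -sumEFin.
  by apply: integrable_sum => // j _; exact: iT.
have -> : #|I|%:R * (C ^+ 2 * K ^+ 2) = \sum_(i : I) (C ^+ 2 * K ^+ 2).
  by rewrite sumr_const mulr_natl.
apply: ler_sum => i _; rewrite Rintegral_sum//.
rewrite (bigD1 i)//= big1 ?addr0; last first.
  by move=> j ji; rewrite RintegralZl// Y0 1?eq_sym// mulr0.
have /andP[c0 ciC] := cC i.
rewrite RintegralZl// -expr2 ler_pM//.
- by rewrite sqr_ge0.
- by apply: Rintegral_ge0 => w _; rewrite -expr2 sqr_ge0.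
- by rewrite lerXn2r// nnegrE (le_trans c0).
- exact: le_Rintegral_cst.
Qed.

(** The second moments have a finite sum, so the series of squares is integrable, hence almost
    surely finite, and its terms tend to 0. *)
Lemma as_cvg_of_second_moment (S : nat -> Omega -> R) (D : R) :
  (forall n, measurable_fun setT (S n)) -> 0 <= D ->
  (forall n, P.-integrable setT (EFin \o (fun w => S n w ^+ 2))) ->
  (forall n, \int[P]_w (S n w ^+ 2) <= D * (n%:R^-1 * n%:R^-1)) ->
  {ae P, forall w, S n w @[n --> \oo] --> (0:R)}.
Proof.
move=> mS D0 iS SD.
have mS2 n : measurable_fun setT (EFin \o (fun w => S n w ^+ 2)).
  by case/integrableP : (iS n).
have S20 n w : (0 <= (S n w ^+ 2)%:E)%E by rewrite lee_fin sqr_ge0.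
pose f w := (\sum_(n <oo) (S n w ^+ 2)%:E)%E.
have mf : measurable_fun setT f.
  apply: ge0_emeasurable_sum => [n w _ _|n _]; [exact: S20|exact: mS2].
have f0 w : (0 <= f w)%E by apply: nneseries_ge0.
have intf : P.-integrable setT f.
  apply/integrableP; split => //.
  under eq_integral do rewrite gee0_abs//.
  rewrite /f integral_nneseries//.
  apply: (@le_lt_trans _ _ (D * 2)%:E); last exact: ltry.
  apply: lime_le; first by apply: is_cvg_nneseries => n _ _; exact: integral_ge0.
  apply: nearW => N.
  have -> : (\sum_(0 <= n < N) \int[P]_w (S n w ^+ 2)%:E)%E =
      (\sum_(0 <= n < N) \int[P]_w (S n w ^+ 2))%:E.
    rewrite -sumEFin; apply: eq_bigr => n _.
    by rewrite fineK//; exact: integrable_fin_num (iS n).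
  rewrite lee_fin (@le_trans _ _ (\sum_(0 <= n < N) D * (n%:R^-1 * n%:R^-1)))//.
    exact: ler_sum.
  by rewrite -mulr_sumr ler_wpM2l// sum_sqr_inv_le.
have := integrable_ae measurableT intf.
apply: filterS => w /(_ I) fw.
have cvg2 : (fun n => S n w ^+ 2) @ \oo --> (0:R).
  apply: cvg_series_cvg_0; apply: nondecreasing_is_cvgn.
    apply/nondecreasing_seqP => n; rewrite /series/= big_nat_recr//= lerDl.
    exact: sqr_ge0.
  exists (fine (f w)) => _ [N _ <-]; rewrite /series/= -lee_fin fineK// -sumEFin.
  exact: nneseries_lim_ge.
apply/cvgr0Pnorm_lt => e e0.
have /cvgr0Pnorm_lt/(_ _ (exprn_gt0 2 e0)) := cvg2.
apply: filterS => n; rewrite normrX => h.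
by rewrite -(@ltr_pXn2r _ 2)// nnegrE ltW.
Qed.

End square_summable.

(** * Mean of a jump chain *)

Section mean_path.
Context {R : realType} {d : measure_display} {Omega : measurableType d}.
Variables (P : probability Omega R) (T : R).
Hypothesis T_ge0 : 0 <= T.
Implicit Types X : R -> {RV P >-> bool}.

Definition mean_path X (t : R) : R := \int[P]_w (X (clamp T t) w)%:R.

Definition centered X (p : BR R * Omega) : R :=
  (X (clamp T p.1) p.2)%:R - mean_path X p.1.

Let up X t := [set w | X t w = true].

Let measurable_up X t : measurable (up X t).
Proof.
have := @measurable_funPTI _ _ _ _ (X t) [set true] I.
by [].
Qed.

Let value_indic X t w : (X t w)%:R = \1_(up X t) w :> R.
Proof.
rewrite indicE; congr (nat_of_bool _)%:R.
by apply/idP/idP => [Xw|/set_mem//]; exact/mem_set.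
Qed.

Lemma mean_pathE X t : mean_path X t = fine (P (up X (clamp T t))).
Proof.
rewrite /mean_path /Rintegral.
under eq_integral do rewrite value_indic.
by rewrite integral_indic// setIT.
Qed.

Lemma mean_path_itv X t : 0 <= mean_path X t <= 1.
Proof.
rewrite mean_pathE fine_ge0//=.
by rewrite -lee_fin fineK ?fin_num_measure// probability_le1.
Qed.

Lemma measurable_mean_path X : (forall omega, cadlag T (X ^~ omega)) ->
  measurable_fun setT (mean_path X).
Proof.
move=> cX; have mX : forall t, measurable_fun setT (X t) by [].
have mZ := measurable_process T_ge0 mX cX.
have mEZ : measurable_fun setT
    (fun p : BR R * Omega => ((X (clamp T p.1) p.2)%:R)%:E : \bar R).
  exact/measurable_EFinP.
have Z0 (p : BR R * Omega) : (0 <= ((X (clamp T p.1) p.2)%:R)%:E :> \bar R)%E.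
  by rewrite lee_fin.
have := @measurable_fun_fubini_tonelli_F _ _ (BR R) Omega R P _ mEZ Z0.
by move=> h; apply: measurableT_comp h.
Qed.

Lemma measurable_centered X : (forall omega, cadlag T (X ^~ omega)) ->
  measurable_fun setT (centered X).
Proof.
move=> cX; have mX : forall t, measurable_fun setT (X t) by [].
apply: measurable_funB; first exact: (measurable_process T_ge0 mX cX).
have mm : measurable_fun setT (mean_path X : BR R -> R) by exact: measurable_mean_path.
exact: (measurableT_comp mm measurable_fst).
Qed.

Lemma centered_le1 X p : `|centered X p| <= 1.
Proof.
rewrite /centered ler_norml; have /andP[m0 m1] := mean_path_itv X p.1.
by case: (X _ _) => /=; apply/andP; split; lra.
Qed.

(** A [bool]-valued variable is determined by one event, so independence of the two events of being
    in state 1 suffices for zero covariance. *)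
Lemma mean_centeredM X Y s t :
  fine (P (up X (clamp T s) `&` up Y (clamp T t))) =
    fine (P (up X (clamp T s))) * fine (P (up Y (clamp T t))) ->
  \int[P]_w (centered X (s, w) * centered Y (t, w)) = 0.
Proof.
rewrite -!mean_pathE => indep; set m := mean_path X s; set m' := mean_path Y t.
set A := up X (clamp T s); set B := up Y (clamp T t).
have mA : measurable A by exact: measurable_up.
have mB : measurable B by exact: measurable_up.
have mAB := measurableI _ _ mA mB.
have i1 (U : set Omega) : measurable U -> P.-integrable setT (EFin \o (\1_U : _ -> R)).
  move=> mU; apply: (@integrable_bounded _ _ _ _ _ 1); first exact: measurable_indic.
  by move=> w; rewrite indicE; case: (_ \in _); rewrite ?normr1 ?normr0.
have iE (U : set Omega) : measurable U -> \int[P]_w (\1_U w : R) = fine (P U).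
  by move=> mU; rewrite /Rintegral integral_indic// setIT.
have iZ (k : R) (U : set Omega) : measurable U ->
    P.-integrable setT (EFin \o (fun w => k * \1_U w : R)).
  by move=> mU; exact: (integrableZl measurableT k (i1 _ mU)).
have ic (k : R) : P.-integrable setT (EFin \o cst k).
  by apply: (@integrable_bounded _ _ _ _ _ `|k|).
have -> : \int[P]_w (centered X (s, w) * centered Y (t, w)) =
    \int[P]_w ((\1_(A `&` B) w - m' * \1_A w) - (m * \1_B w - m * m')).
  apply: eq_Rintegral => w _; rewrite /centered/= !value_indic indicI /=.
  by rewrite -/A -/B -/m -/m'; ring.
have iAB : P.-integrable setT (EFin \o (fun w => \1_(A `&` B) w - m' * \1_A w)).
  exact: (integrableB measurableT (i1 _ mAB) (iZ m' _ mA)).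
have iBc : P.-integrable setT (EFin \o (fun w => m * \1_B w - m * m')).
  exact: (integrableB measurableT (iZ m _ mB) (ic (m * m'))).
rewrite (RintegralB measurableT iAB iBc).
rewrite (RintegralB measurableT (i1 _ mAB) (iZ m' _ mA)).
rewrite (RintegralB measurableT (iZ m _ mB) (ic (m * m'))).
rewrite (RintegralZl m' measurableT (i1 _ mA)) (RintegralZl m measurableT (i1 _ mB)).
rewrite !iE// Rintegral_cst_prob /A /B -!mean_pathE.
by rewrite indep -/m -/m'; ring.
Qed.

End mean_path.

Section chain_drift.
Context {R : realType} {d : measure_display} {Omega : measurableType d}.
Variables (P : probability Omega R) (T : R).
Hypothesis T_ge0 : 0 <= T.
Local Notation lam := (@lebesgue_measure R).

(** The Markov property from time 0, with the sure event as history, identifies the mean at [u] with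
    [p 0 u x0 true]. With two states, the other probability is one minus it, so the forward equation
    closes on the mean. *)
Lemma mean_path_forward (up down : R -> R) (x0 : bool) (X : R -> {RV P >-> bool}) t :
  jump_chain T up down x0 X -> 0 <= t <= T ->
  mean_path T X t = x0%:R + \int[lam]_(u in `[0, t]%classic)
    (up u * (1 - mean_path T X u) - down u * mean_path T X u).
Proof.
move=> [X0 _ [p tp Xp]] t0T.
have mE u : 0 <= u <= T -> mean_path T X u = p 0 u x0 true.
  move=> /andP[u0 uT]; rewrite mean_pathE clamp_id ?u0//.
  have hT : history X 0 setT.
    rewrite /history; set G := \bigcup_(_ in _) _.
    have [h0 hC _] := smallest_sigma_algebra setT G.
    by have := hC _ h0; rewrite setD0.
  have u00 : 0 <= (0:R) <= u by rewrite lexx.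
  have := Xp 0 u setT x0 true u00 uT hT.
  have -> : [set omega | X 0 omega = x0] = setT by apply/seteqP; split => // w _; exact: X0.
  by rewrite !setTI probability_setT mule1 => ->.
rewrite mE//; have /andP[t0 tT] := t0T.
rewrite (kolmogorov_forward tp); [|by rewrite lexx|by []].
rewrite (_ : (x0 == true) = x0); last by case: (x0).
congr (_ + _); apply: eq_Rintegral => u /set_mem/=; rewrite in_itv/= => /andP[u0 ut].
have uT : u <= T by exact: le_trans tT.
have := @transition_sum1 _ _ _ _ tp 0 u x0; rewrite lexx u0 => /(_ isT uT).
rewrite !big_bool/= mE ?u0// => s1.
rewrite (_ : p 0 u x0 false = 1 - p 0 u x0 true); last by rewrite -s1; ring.
by ring.
Qed.

(** By the forward equation, [a] times the integral is the mean at [t] minus the initial state, both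
    in [[0, 1]]. The bound is uniform in [t] and in the rates. *)
Lemma chain_drift_le (a : R) (bp bm : R -> R) (x0 : bool) (X : R -> {RV P >-> bool}) t :
  0 < a -> jump_chain T (fun t => a * bp t) (fun t => a * bm t) x0 X ->
  0 <= t <= T ->
  lam.-integrable `[0, T] (EFin \o bp) -> lam.-integrable `[0, T] (EFin \o bm) ->
  `|\int[lam]_(u in `[0, t]%classic)
     (bp u - (bp u + bm u) * mean_path T X u)| <= a^-1.
Proof.
move=> a0 jc t0T ip im.
have cX : forall omega, cadlag T (X ^~ omega) by case: jc.
have m0 u := mean_path_itv T X u.
have /andP[t0 tT] := t0T.
have mt : measurable (`[0, t]%classic : set (BR R)) by exact: measurable_itv.
have tTS : (`[0, t]%classic : set R) `<=` `[0, T]%classic.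
  by apply: subset_itvl; rewrite bnd_simp.
have mm : measurable_fun setT (mean_path T X : BR R -> R).
  exact: measurable_mean_path.
have ibm (b : R -> R) : lam.-integrable `[0, T] (EFin \o b) ->
    lam.-integrable `[0, t] (EFin \o b) /\
    lam.-integrable `[0, t] (EFin \o (fun u => b u * mean_path T X u)).
  move=> ib; have ibt : lam.-integrable `[0, t] (EFin \o b).
    by apply: integrableS ib => //; exact: measurable_itv.
  split => //; apply: (le_integrable mt _ _ ibt).
    apply/measurable_EFinP; apply: measurable_funM; last exact: measurable_funS mm.
    by case/integrableP : ibt => /measurable_EFinP.
  move=> u _ /=; rewrite lee_fin normrM ler_piMr//.
  by have /andP[? ?] := m0 u; rewrite ger0_norm.
have [ip1 ip2] := ibm _ ip; have [im1 im2] := ibm _ im.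
have iI : lam.-integrable `[0, t]
    (EFin \o (fun u => bp u - (bp u + bm u) * mean_path T X u)).
  have := integrableB mt ip1 (integrableD mt ip2 im2).
  apply: eq_integrable => // u _ /=.
  by rewrite mulrDl.
have := mean_path_forward jc t0T.
have -> : \int[lam]_(u in `[0, t]%classic) (a * bp u * (1 - mean_path T X u) -
      a * bm u * mean_path T X u) =
    a * \int[lam]_(u in `[0, t]%classic) (bp u - (bp u + bm u) * mean_path T X u).
  by rewrite -RintegralZl//; apply: eq_Rintegral => u _; ring.
set I := \int[lam]_(u in _) _ => e.
have aI : `|a * I| <= 1.
  have -> : a * I = mean_path T X t - x0%:R by rewrite e addrC addKr.
  have /andP[h1 h2] := m0 t; rewrite ler_norml.
  by case: (x0) => /=; apply/andP; split; lra.
rewrite -(ler_pM2l a0) divff ?lt0r_neq0//; move: aI.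
by rewrite normrM (gtr0_norm a0).
Qed.

End chain_drift.

(** * Fluctuations *)

Section step_values.
Context {R : realType}.

(** The strict lower endpoint of a cell separates it from all earlier ones; the first cell, closed
    at 0, has no predecessor. *)
Lemma cell_inj n (i j : 'I_n) (x : R) : cell i x -> cell j x -> i = j.
Proof.
have bounds (k : 'I_n) : cell k x -> (k != 0%N :> nat -> k%:R / n%:R < x) /\ x <= k.+1%:R / n%:R.
  rewrite /cell; case: ifPn => [/eqP ->|k0] /=; rewrite in_itv/= => /andP[h1 h2].
    by rewrite mul1r.
  by [].
have n0 : 0 < n%:R^-1 :> R by rewrite invr_gt0 ltr0n (leq_ltn_trans _ (ltn_ord i)).
have lt_absurd (k l : 'I_n) : (k < l)%N -> cell k x -> cell l x -> False.
  move=> kl /bounds[_ xk] /bounds[/(_ _) xl _].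
  have /xl : l != 0%N :> nat by rewrite -lt0n (leq_ltn_trans _ kl).
  by rewrite ltNge (le_trans xk)// ler_pM2r// ler_nat.
move=> xi xj; apply/val_inj => /=; case: (ltngtP i j) => // ij.
- by have := lt_absurd _ _ ij xi xj.
- by have := lt_absurd _ _ ij xj xi.
Qed.

Lemma cell_cover n (x : R) : (0 < n)%N -> 0 <= x <= 1 -> exists i : 'I_n, cell i x.
Proof.
move=> n0 /andP[x0 x1]; have nR : 0 < n%:R :> R by rewrite ltr0n.
have ex : exists k, x <= k%:R / n%:R by exists n; rewrite divff ?lt0r_neq0.
(* The least [k] with [x <= k / n] names the cell, shifted by one. At [x = 0] it is 0, and
   [0.-1 = 0] still gives the first cell. *)
case: (ex_minnP ex) => k xk kmin.
have kn : (k <= n)%N by apply: kmin; rewrite divff ?lt0r_neq0.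
have kn' : (k.-1 < n)%N by case: k kn {xk kmin}.
exists (Ordinal kn'); rewrite /cell/=; case: ifPn => [/eqP k1|k1] /=; rewrite in_itv/=.
  rewrite x0/= (le_trans xk)// ler_pdivrMr// mulVf ?lt0r_neq0//.
  by case: k k1 {xk kmin kn kn'} => [|[|]].
have k0 : (0 < k)%N by case: k k1 {xk kmin kn kn'}.
rewrite prednK// xk andbT ltNge; apply/negP => /kmin.
by rewrite leqNgt ltn_predL k0.
Qed.

(** The pair of indices is the same for all [f], so a pointwise relation between step functions
    reduces to one entry, once it holds for zero. *)
Lemma stepP n (p : BR R * BR R * BR R) :
  (forall f : 'I_n -> 'I_n -> R -> R, step f p = 0) \/
  exists i j : 'I_n, forall f, step f p = f i j p.2.
Proof.
have [[i [j [pi pj]]]|no] := pselect (exists i j : 'I_n, cell i p.1.1 /\ cell j p.1.2).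
  right; exists i, j => f; rewrite /step (bigD1 i)//= [X in _ + X]big1 ?addr0; last first.
    move=> k ki; apply: big1 => l _; rewrite indicE memNset ?mulr0//= => -[pk _].
    by move/eqP : ki; apply; exact: cell_inj pk pi.
  rewrite (bigD1 j)//= [X in _ + X]big1 ?addr0.
    by rewrite indicE mem_set ?mulr1.
  move=> l lj; rewrite indicE memNset ?mulr0//= => -[_ pl].
  by move/eqP : lj; apply; exact: cell_inj pl pj.
left=> f; apply: big1 => i _; apply: big1 => j _.
by rewrite indicE memNset ?mulr0// => -[pi pj]; apply: no; exists i, j.
Qed.

Lemma step_cube (T : R) n p : (0 < n)%N -> cube T p ->
  exists i j : 'I_n, forall f : 'I_n -> 'I_n -> R -> R, step f p = f i j p.2.
Proof.
case: p => [[x y] t] n0 [/= [/= x01 y01] _].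
move: x01 y01; rewrite !in_itv/= => x01 y01.
have [i xi] := cell_cover n0 x01; have [j yj] := cell_cover n0 y01.
(* Tested on the constant 1, the vanishing alternative would make a sum of nonnegative terms, one of
   them 1, equal to 0. *)
have [/(_ (fun _ _ _ => 1))|//] := stepP n (x, y, t).
rewrite /step (bigD1 i)//= (bigD1 j)//= indicE mem_set// mul1r => /eqP.
suff h : forall z : R, 0 <= z -> 1 + z == 0 = false.
  rewrite -addrA h//; rewrite addr_ge0//; first by apply: sumr_ge0 => *; rewrite mul1r.
  by apply: sumr_ge0 => *; apply: sumr_ge0 => *; rewrite mul1r.
by move=> z z0; rewrite gt_eqF// ltr_pwDl.
Qed.

Lemma step_itv01 n (f : 'I_n -> 'I_n -> R -> R) p :
  (forall i j t, 0 <= f i j t <= 1) -> 0 <= step f p <= 1.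
Proof.
move=> f01; have [->|[i [j ->]]] := stepP n p; first by rewrite lexx ler01.
exact: f01.
Qed.

Lemma stepB n (f g : 'I_n -> 'I_n -> R -> R) p :
  step f p - step g p = step (fun i j t => f i j t - g i j t) p.
Proof.
by have [h|[i [j h]]] := stepP n p; rewrite !h ?subr0.
Qed.

End step_values.

Section fluctuations.
Context {R : realType} {d : measure_display} {Omega : measurableType d}.
Variables (P : probability Omega R) (T : R).
Hypothesis T_gt0 : 0 < T.
Let T_ge0 : 0 <= T := ltW T_gt0.
Local Notation lam := (@lebesgue_measure R).

(** Histories up to [T] contain the events at all times in [[0, T]], so the two variables may be
    taken at different times. *)
Lemma mutually_independent_centered (I : finType) (X : I -> R -> {RV P >-> bool}) :
  mutually_independent P (fun i => history (X i) T) ->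
  forall i j s t, i != j ->
    \int[P]_w (centered T (X i) (s, w) * centered T (X j) (t, w)) = 0.
Proof.
move=> ind i j s t ij; apply: mean_centeredM => //.
pose A k := if k == i then [set w | X i (clamp T s) w = true]
            else [set w | X j (clamp T t) w = true].
have inH (k : I) (u : R) : history (X k) T [set w | X k (clamp T u) w = true].
  apply: sub_sigma_algebra; exists (clamp T u); first by rewrite /= in_itv/= clamp_itv.
  by exists [set true] => //; rewrite setTI.
have hA k : k \in [set i; j]%SET -> history (X k) T (A k).
  rewrite !inE /A => /orP[/eqP ->|/eqP ->]; first by rewrite eqxx; exact: inH.
  by rewrite eq_sym (negbTE ij); exact: inH.
have Ai : A i = [set w | X i (clamp T s) w = true] by rewrite /A eqxx.
have Aj : A j = [set w | X j (clamp T t) w = true] by rewrite /A eq_sym (negbTE ij).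
have := ind [set i; j]%SET A hA.
rewrite big_setU1 ?inE//= big_set1 Ai Aj => <-; congr (fine (P _)).
apply/seteqP; split => w.
  by move=> [wi wj] k /=; rewrite !inE => /orP[/eqP ->|/eqP ->]; rewrite ?Ai ?Aj.
move=> h; split.
- by have := h i; rewrite /= !inE eqxx Ai; exact.
- by have := h j; rewrite /= !inE eqxx orbT Aj; exact.
Qed.

Lemma ae_cvg_fluctuation (X : forall n, 'I_n -> 'I_n -> R -> {RV P >-> bool})
    (A1 A2 A3 : set (BR R)) :
  (forall n i j omega, cadlag T (fun t => X n i j t omega)) ->
  (forall n, mutually_independent P
    (fun ij : 'I_n * 'I_n => history (X n ij.1 ij.2) T)) ->
  measurable A1 -> measurable A2 -> measurable A3 ->
  {ae P, forall w, \int[lebesgue_cube T]_(p in A1 `*` A2 `*` A3)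
     step (fun i j t => centered T (X n i j) (t, w)) p @[n --> \oo] --> (0 : R)}.
Proof.
move=> cX iX mA1 mA2 mA3.
pose E : set (BR R) := A3 `&` `[0, T].
have mE : measurable E by apply: measurableI => //; exact: measurable_itv.
have ET : (lam E <= T%:E)%E.
  have -> : T%:E = lam `[0, T]%classic.
    by rewrite lebesgue_measure_itv/= lte_fin T_gt0 oppr0 adde0.
  by apply: le_measure; try apply: mem_set => //; exact: subIsetr.
have Eoo : (lam E < +oo)%E by rewrite (le_lt_trans ET)// ltry.
have fET : fine (lam E) <= T by rewrite -lee_fin fineK// ge0_fin_numE.
have mZ n i j := measurable_centered T_ge0 (cX n i j).
have Z1 n i j := @centered_le1 _ _ _ P T (X n i j).
pose Y n (ij : 'I_n * 'I_n) w : R := \int[lam]_(t in E) centered T (X n ij.1 ij.2) (t, w).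
pose cw n (ij : 'I_n * 'I_n) : R := cell_weight A1 A2 ij.1 ij.2.
have mY n ij : measurable_fun setT (Y n ij).
  exact: (measurable_time_integral P (mZ _ _ _) (Z1 _ _ _) mE Eoo).
have YT n ij w : `|Y n ij w| <= T.
  have := time_integral_le (mZ n ij.1 ij.2) (Z1 n ij.1 ij.2) mE Eoo w.
  by rewrite mul1r => /le_trans; exact.
have YY n ij kl : ij != kl -> \int[P]_w (Y n ij w * Y n kl w) = 0.
  move=> ijkl.
  (* The integral in [Y n kl] is opened first, with [Y n ij] as the bounded factor; the one in
     [Y n ij] follows, at a fixed time [t]. *)
  apply: (orthogonal_time_integral (mZ n kl.1 kl.2) (Z1 n kl.1 kl.2) mE Eoo
    (mY n ij) (YT n ij)) => t Et.
  under eq_Rintegral do rewrite mulrC.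
  have mG : measurable_fun setT (fun w => centered T (X n kl.1 kl.2) (t, w)).
    exact: measurableT_comp.
  apply: (orthogonal_time_integral (mZ n ij.1 ij.2) (Z1 n ij.1 ij.2) mE Eoo
    mG (fun w => Z1 n kl.1 kl.2 (t, w))) => s Es.
  have := mutually_independent_centered (iX n) t s; apply.
  by rewrite eq_sym.
pose S n w := \sum_ij cw n ij * Y n ij w.
have SE n w : \int[lebesgue_cube T]_(p in A1 `*` A2 `*` A3)
     step (fun i j t => centered T (X n i j) (t, w)) p = S n w.
  have mZw i j : measurable_fun setT (fun t : R => centered T (X n i j) (t, w)).
    exact: (measurableT_comp (mZ n i j) (measurable_pair2 w)).
  rewrite Rintegral_step//.
    by rewrite pair_big.
  move=> i j; have mI : measurable (`[0, T]%classic : set (BR R)) by exact: measurable_itv.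
  have Ioo : (lam `[0%R, T]%classic < +oo)%E.
    by rewrite lebesgue_measure_itv/=; case: ifP => // _; rewrite -EFinD ltry.
  exact: (integrable_section (mZ n i j) (Z1 n i j) mI Ioo w).
have mS n : measurable_fun setT (S n).
  apply: measurable_sum => ij; apply: measurable_funM => //; exact: mY.
(* There are [n^2] orthogonal terms, with weights at most [n^-2] and values at most [T]. *)
have S2 n : \int[P]_w (S n w ^+ 2) <= T ^+ 2 * (n%:R^-1 * n%:R^-1).
  apply: (le_trans (second_moment_orthogonal (mY n) (YT n) (YY n)
     (C := n%:R^-1 * n%:R^-1) _)).
    by move=> ij; rewrite cell_weight_ge0 cell_weight_le.
  (* For [n = 0] both sides vanish, since [0^-1 = 0]. *)
  rewrite card_prod card_ord natrM; have [->|n0] := eqVneq n 0%N.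
    by rewrite !mul0r invr0 mul0r mulr0.
  rewrite le_eqVlt; apply/orP; left; apply/eqP; field.
  by rewrite pnatr_eq0.
have Sb n w : `|S n w| <= \sum_ij cw n ij * T.
  rewrite (le_trans (ler_norm_sum _ _ _))//; apply: ler_sum => ij _.
  by rewrite normrM ger0_norm ?cell_weight_ge0// ler_wpM2l ?cell_weight_ge0.
have iS n : P.-integrable setT (EFin \o (fun w => S n w ^+ 2)).
  apply: (@integrable_bounded _ _ _ _ _ ((\sum_ij cw n ij * T) ^+ 2)).
    exact: measurable_funX.
  by move=> w; rewrite normrX lerXn2r ?nnegrE// (le_trans _ (Sb n w)).
have := as_cvg_of_second_moment mS (sqr_ge0 T) iS S2.
by apply: filterS => w; under eq_fun do rewrite -SE.
Qed.

End fluctuations.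

(** * The weak topology of [W0] *)

Section boxes.
Context {R : realType}.

(** [None] gives the whole line, so that the whole space is a box, as the pi-lambda argument
    requires, and so that a box can constrain a single coordinate. *)
Definition rational_ray (o : option rat) : set (BR R) :=
  if o is Some q then `]-oo, ratr q]%classic else setT.

Definition box (k : option rat * option rat * option rat) : set (BR R * BR R * BR R) :=
  rational_ray k.1.1 `*` rational_ray k.1.2 `*` rational_ray k.2.

Lemma measurable_rational_ray o : measurable (rational_ray o).
Proof. by case: o => [q|]; [exact: measurable_itv|exact: measurableT]. Qed.

Lemma measurable_box k : measurable (box k).
Proof. by do 2?apply: measurableX; exact: measurable_rational_ray. Qed.

Lemma rational_rayI o1 o2 : exists o, rational_ray o1 `&` rational_ray o2 = rational_ray o.
Proof.
case: o1 => [q1|]; last by exists o2; rewrite setTI.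
case: o2 => [q2|]; last by exists (Some q1); rewrite setIT.
exists (Some (Num.min q1 q2)); apply/seteqP; rewrite /rational_ray/=.
have [q12|q12] := leP q1 q2; have q12R : ratr q1 <= ratr q2 :> R \/ ratr q2 <= ratr q1 :> R.
- by left; rewrite ler_rat.
- split=> x /=; rewrite !in_itv/=; first by case.
  by move=> h; split => //; rewrite (le_trans h)// ler_rat.
- by right; rewrite ler_rat ltW.
- split=> x /=; rewrite !in_itv/=; first by case.
  by move=> h; split => //; rewrite (le_trans h)// ler_rat ltW.
Qed.

Lemma boxI : setI_closed (range box).
Proof.
move=> _ _ [[[a1 a2] a3] _ <-] [[[b1 b2] b3] _ <-]; rewrite /box/= -!setXI.
have [c1 ->] := rational_rayI a1 b1; have [c2 ->] := rational_rayI a2 b2.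
by have [c3 ->] := rational_rayI a3 b3; exists (c1, c2, c3).
Qed.

Lemma boxT : range box setT.
Proof. by exists (None, None, None); rewrite // /box/= !setXTT. Qed.

Lemma rational_ray_generate :
  (measurable : set (set (BR R))) `<=` <<s range rational_ray >>.
Proof.
rewrite (_ : measurable = (@ocitv R).-sigma.-measurable)// RGenOInfty.measurableE.
apply: smallest_sub; first exact: smallest_sigma_algebra.
move=> _ [x ->].
(* []x, +oo[] is the union of []q, +oo[] over the rationals [q >= x]. The type of [F] makes
   measurability refer to the generated sigma-algebra. *)
pose F (q : rat) : set (g_sigma_algebraType (range rational_ray)) :=
  if x <= ratr q then ~` rational_ray (Some q) else set0.
have -> : `]x, +oo[%classic = \bigcup_q F q.
  apply/seteqP; split => y /=; rewrite in_itv/= andbT.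
    move=> xy; have [q] := rat_in_itvoo xy; rewrite in_itv/= => /andP[xq qy].
    exists q => //; rewrite /F ltW//= in_itv/=.
    by apply/negP; rewrite -ltNge.
  move=> [q _]; rewrite /F; case: ifPn => //= xq; rewrite in_itv/= => /negP.
  by rewrite -ltNge; exact: le_lt_trans.
suff : measurable (\bigcup_q F q) by [].
apply: bigcupT_measurable_rat => q; rewrite /F; case: ifPn => // _.
by apply: measurableC; apply: sub_sigma_algebra; exists (Some q).
Qed.

(** Good sets principle: the sets whose preimage lies in [G] form a sigma-algebra. *)
Let sub_preimage (S1 S2 : Type) (f : S1 -> S2) (G : set (set S1)) (K : set (set S2)) :
  sigma_algebra setT G -> (forall A, K A -> G (f @^-1` A)) ->
  forall A, <<s K >> A -> G (f @^-1` A).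
Proof.
move=> [G0 GC GU] KG; apply: smallest_sub => //; split => /=.
- by rewrite preimage_set0.
- by move=> A GA; rewrite setTD preimage_setC -setTD; exact: GC.
- by move=> F GF; rewrite preimage_bigcup; exact: GU.
Qed.

Lemma box_generate :
  (measurable : set (set (BR R * BR R * BR R))) = <<s range box >>.
Proof.
apply/seteqP; split; last first.
  apply: smallest_sub; first exact: sigma_algebra_measurable.
  by move=> _ [k _ <-]; exact: measurable_box.
have sG := smallest_sigma_algebra setT (range box).
have coord (f : BR R * BR R * BR R -> BR R) :
    (forall o, <<s range box >> (f @^-1` rational_ray o)) ->
    forall A, measurable A -> <<s range box >> (f @^-1` A).
  move=> fo A /rational_ray_generate; apply: sub_preimage => //.
  by move=> _ [q _ <-]; exact: fo.
have boxE k : <<s range box >> (box k) by apply: sub_sigma_algebra; exists k.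
have c1 : forall A, measurable A -> <<s range box >> ((fst \o fst) @^-1` A).
  apply: coord => o; rewrite (_ : _ @^-1` _ = box (o, None, None)); first exact: boxE.
  by apply/seteqP; split => -[[x y] z]; rewrite /box/=; tauto.
have c2 : forall A, measurable A -> <<s range box >> ((snd \o fst) @^-1` A).
  apply: coord => o; rewrite (_ : _ @^-1` _ = box (None, o, None)); first exact: boxE.
  by apply/seteqP; split => -[[x y] z]; rewrite /box/=; tauto.
have c3 : forall A, measurable A -> <<s range box >> (snd @^-1` A).
  apply: coord => o; rewrite (_ : _ @^-1` _ = box (None, None, o)); first exact: boxE.
  by apply/seteqP; split => -[[x y] z]; rewrite /box/=; tauto.
have c12 : forall A : set (BR R * BR R), measurable A -> <<s range box >> (fst @^-1` A).
  apply: sub_preimage => // A [] [B mB <-]; rewrite setTI.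
  - exact: c1.
  - exact: c2.
apply: smallest_sub => // A [] [B mB <-]; rewrite setTI.
- exact: c12.
- exact: c3.
Qed.

End boxes.

Lemma cvg_initial_topology (S : choiceType) (U : topologicalType) (f : S -> U)
    (u : nat -> S) (s : S) :
  f (u n) @[n --> \oo] --> f s ->
  u n @[n --> \oo] --> (s : initial_topology f).
Proof.
move=> h A; rewrite nbhsE => -[B [[C oC <-] Cs] BA].
have : \forall n \near \oo, C (f (u n)) by apply: h; exact: open_nbhs_nbhs.
by apply: filterS => n Cn; exact: BA.
Qed.

Section weak_convergence.
Context {R : realType} (T : R).
Hypothesis T_gt0 : 0 < T.
Local Notation mu := (lebesgue_cube T).
Local Notation R3 := (BR R * BR R * BR R)%type.

Lemma lebesgue_cube_fin : (mu setT < +oo)%E.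
Proof.
have I1 : lebesgue_measure (`[0, 1] : set R) = 1%E.
  by rewrite lebesgue_measure_itv/= lte_fin ltr01 oppr0 adde0.
have IT : lebesgue_measure (`[0, T] : set R) = T%:E.
  by rewrite lebesgue_measure_itv/= lte_fin T_gt0 oppr0 adde0.
have m01 : measurable (`[0, 1]%classic : set (BR R)) by exact: measurable_itv.
have mT : measurable (`[0, T]%classic : set (BR R)) by exact: measurable_itv.
have -> : mu setT = lebesgue3 (cube T) by congr (lebesgue3 _); exact: setTI.
rewrite /cube /lebesgue3/=.
rewrite (product_measure1E lebesgue2)//; last exact: measurableX.
rewrite /lebesgue2/= product_measure1E//.
by rewrite [X in (X * _ * _)%E]I1 [X in (_ * X * _)%E]I1 [X in (_ * _ * X)%E]IT !mul1e ltry.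
Qed.

Lemma integrable_cube_bounded (f : R3 -> R) (k : R) : measurable_fun setT f ->
  (forall p, `|f p| <= k) -> mu.-integrable setT (EFin \o f).
Proof.
move=> mf fk; apply: measurable_bounded_integrable => //; first exact: lebesgue_cube_fin.
exists k; split; first exact: num_real.
by move=> y /ltW ky p _; apply: le_trans ky.
Qed.

End weak_convergence.

Section W0_topology.
Context {R : realType} (T : R).
Hypothesis T_gt0 : 0 < T.
Local Notation mu := (lebesgue_cube T).
Local Notation R3 := (BR R * BR R * BR R)%type.

(** A representative of the class [u]; its bounds hold only almost everywhere. *)
Definition W0_fun (u : W0 T) : R3 -> R := (set_val u : L2 T).

Lemma measurable_L2 (g : L2 T) : measurable_fun setT (g : R3 -> R).
Proof.
move=> mR Y mY.
exact: (@measurable_funPT _ _ _ _ (repr (g : {mfun_ mu, R3 >-> BR R})) mR Y mY).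
Qed.

Lemma measurable_W0_fun (u : W0 T) : measurable_fun setT (W0_fun u).
Proof. exact: measurable_L2. Qed.

Lemma W0_fun_itv (u : W0 T) : {ae mu, forall p, 0 <= W0_fun u p <= 1}.
Proof. exact: (set_valP u). Qed.

Lemma integrable_L2 (g : L2 T) : mu.-integrable setT (EFin \o (g : R3 -> R)).
Proof.
apply/Lfun1_integrable; apply: Lfun_subset12.
  by rewrite ge0_fin_numE//; exact: lebesgue_cube_fin.
by apply/andP; split; apply: mem_set; [exact: measurable_L2|exact: Lebesgue_finite].
Qed.

(** The bridge from functions to points of [W0]: the [L^2] norm is finite because [f] is bounded and
    the cube has finite measure. *)
Lemma exists_W0 (f : R3 -> R) : measurable_fun setT f -> (forall p, 0 <= f p <= 1) ->
  exists u : W0 T, W0_fun u = f %[ae mu].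
Proof.
move=> mf f01.
have mf' : measurable_fun setT (f : R3 -> BR R) by move=> mR Y mY; exact: (mf mR Y mY).
pose f' : {mfun R3 >-> BR R} := HB.pack f (isMeasurableFun.Build _ _ R3 (BR R) f mf').
pose u0 : {mfun_ mu, R3 >-> BR R} := (\pi f')%qT.
have u0f : (u0 : R3 -> R) = f %[ae mu].
  have : (repr u0 == f' %[mod {mfun_ mu, R3 >-> BR R}])%qT by rewrite reprK.
  by rewrite eqmodE => /asboolP.
have mu0 : measurable_fun setT (u0 : R3 -> R).
  by move=> mR Y mY; exact: (measurable_funPT (repr u0) mR Y mY).
have fin0 : finite_norm mu 2 (u0 : R3 -> R).
  rewrite /finite_norm unlock poweR_lty//.
  rewrite (eq_integral (fun p => (`|u0 p| `^ 2)%:E))//.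
  apply: (@le_lt_trans _ _ (\int[mu]_p (cst 1 p)%:E)%E).
    apply: ae_ge0_le_integral => //.
    - apply/measurable_EFinP; apply: (measurableT_comp (measurable_powR _)).
      exact: measurableT_comp.
    - exact/measurable_EFinP.
    - move: u0f; apply: filterS => p /(_ I) -> _ /=.
      have /andP[f0 f1] := f01 p.
      by rewrite lee_fin ger0_norm// powR_mulrn// exprn_ile1.
  by rewrite [ltLHS](integral_cst mu measurableT 1%E) mul1e; exact: lebesgue_cube_fin.
pose u : L2 T := HB.pack u0 (isFinLebesgue.Build _ _ _ _ _ _ u0 fin0).
have uW : W0 T u.
  by move: u0f; apply: filterS => p /(_ I) up; rewrite [_ p]up.
exists (SigSub (mem_set uW) : W0 T).
exact: u0f.
Qed.

(** Representatives lie in [[0, 1]] only almost everywhere; clipping them gives the bound at every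
    point that [dominated_weak_cvg] asks for. *)
Let clip (x : R) : R := Num.max 0 (Num.min x 1).

Let clip_itv x : 0 <= clip x <= 1.
Proof. by rewrite /clip le_max lexx/= ge_max ler01 ge_min lexx orbT. Qed.

Let clip_id x : 0 <= x <= 1 -> clip x = x.
Proof. by move=> /andP[x0 x1]; rewrite /clip min_l// max_r. Qed.

Let measurable_clip (f : R3 -> R) : measurable_fun setT f -> measurable_fun setT (clip \o f).
Proof.
by move=> mf; apply: measurable_maxr => //; exact: measurable_minr.
Qed.

Let ae_clip (u : W0 T) : {ae mu, forall p, clip (W0_fun u p) = W0_fun u p}.
Proof. by apply: filterS (W0_fun_itv u) => p; exact: clip_id. Qed.

Let ae_Rintegral (A : set R3) (f g : R3 -> R) : measurable A ->
  measurable_fun setT f -> measurable_fun setT g ->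
  {ae mu, forall p, f p = g p} -> \int[mu]_(p in A) f p = \int[mu]_(p in A) g p.
Proof.
move=> mA mf mg fg; congr fine; apply: ae_eq_integral => //.
- by apply/measurable_EFinP; exact: measurable_funS mf.
- by apply/measurable_EFinP; exact: measurable_funS mg.
- by apply: filterS fg => p -> _.
Qed.

(** Differences of clipped representatives are bounded by 1, and [L^2] functions are integrable on
    the cube, so [dominated_weak_cvg] applies with [B] equal to 1. *)
Lemma W0_cvg (f : nat -> W0 T) (f0 : W0 T) :
  (forall k, \int[mu]_(p in box k) W0_fun (f n) p @[n --> \oo] -->
    \int[mu]_(p in box k) W0_fun f0 p) ->
  f n @[n --> \oo] --> f0.
Proof.
(* The layers of the topology are peeled off: subspace, initial topology for [pairing], then
   pointwise convergence, which leaves one test function [g]. *)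
move=> ff0; apply: cvg_initial_topology; apply: cvg_initial_topology.
apply/cvg_sup => g; apply: cvg_initial_topology.
pose F n p := clip (W0_fun (f n) p) - clip (W0_fun f0 p).
have mc u : measurable_fun setT (clip \o W0_fun u).
  exact: (measurable_clip (@measurable_W0_fun u)).
have mF n : measurable_fun setT (F n) by apply: measurable_funB; exact: mc.
have F1 n p : `|F n p| <= (fun _ : R3 => 1) p.
  have /andP[h1 h2] := clip_itv (W0_fun (f n) p).
  have /andP[h3 h4] := clip_itv (W0_fun f0 p).
  by rewrite ler_norml /F/=; apply/andP; split; lra.
have i1 : mu.-integrable setT (EFin \o (fun _ : R3 => 1 : R)).
  by apply: (integrable_cube_bounded T_gt0 (k := 1)) => // p; rewrite normr1.
have mg := measurable_L2 g; have ig := integrable_L2 g.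
have iug (u : W0 T) : mu.-integrable setT (EFin \o (fun p => clip (W0_fun u p) * g p)).
  apply: (integrable_bounded_mul (k := 1) _ _ ig).
  - exact: mc.
  - by move=> p; have /andP[h1 h2] := clip_itv (W0_fun u p); rewrite ger0_norm.
have ic (u : W0 T) A : measurable A ->
    mu.-integrable A (EFin \o (fun p => clip (W0_fun u p))).
  move=> mA; apply: (@integrableS _ _ _ _ setT) => //.
  apply: (integrable_cube_bounded T_gt0 (k := 1)); first exact: mc.
  by move=> p; have /andP[h1 h2] := clip_itv (W0_fun u p); rewrite ger0_norm.
have FC A : range box A -> \int[mu]_(x in A) F n x @[n --> \oo] --> (0:R).
  move=> [k _ <-]; have mk := @measurable_box R k.
  have E n : \int[mu]_(x in box k) F n x =
      \int[mu]_(p in box k) W0_fun (f n) p - \int[mu]_(p in box k) W0_fun f0 p.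
    rewrite (RintegralB mk (ic (f n) _ mk) (ic f0 _ mk)); congr (_ - _).
    - exact: (ae_Rintegral mk (mc _) (@measurable_W0_fun _) (ae_clip _)).
    - exact: (ae_Rintegral mk (mc _) (@measurable_W0_fun _) (ae_clip _)).
  rewrite (funext E); set l := \int[mu]_(p in box k) W0_fun f0 p.
  have : (fun n => \int[mu]_(p in box k) W0_fun (f n) p - l) @ \oo --> l - l.
    by apply: cvgB; [exact: ff0|exact: cvg_cst].
  by rewrite subrr.
have i1g : mu.-integrable setT (EFin \o (fun p => 1 * g p)).
  by rewrite (_ : _ \o _ = EFin \o (g : R3 -> R))//; apply/funext => p /=; rewrite mul1r.
have Fg := dominated_weak_cvg mF F1 i1 boxI box_generate boxT FC mg i1g.
have mul_clip (u : W0 T) : pairing (set_val u) g = \int[mu]_p (clip (W0_fun u p) * g p).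
  apply: ae_Rintegral => //.
  - by apply: measurable_funM => //; exact: measurable_W0_fun.
  - by apply: measurable_funM => //; exact: mc.
  - by apply: filterS (ae_clip u) => p ->.
change ((fun n => pairing (set_val (f n)) g) @ \oo --> pairing (set_val f0) g).
rewrite mul_clip (funext (fun n => mul_clip (f n))).
have E n : \int[mu]_p (clip (W0_fun (f n) p) * g p) =
    \int[mu]_p (clip (W0_fun f0 p) * g p) + \int[mu]_p (F n p * g p).
  have -> : \int[mu]_p (F n p * g p) = \int[mu]_p (clip (W0_fun (f n) p) * g p) -
      \int[mu]_p (clip (W0_fun f0 p) * g p).
    rewrite -RintegralB//; apply: eq_Rintegral => p _; exact: mulrBl.
  by rewrite addrC subrK.
rewrite (funext E); set l := \int[mu]_p (clip (W0_fun f0 p) * g p).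
have : (fun n => l + \int[mu]_p (F n p * g p)) @ \oo --> l + 0.
  by apply: cvgD; [exact: cvg_cst|exact: Fg].
by rewrite addr0.
Qed.

End W0_topology.

(** * Borel measurability of maps into [W0] *)

Section W0_borel.
Context {R : realType} (T : R).
Hypothesis T_gt0 : 0 < T.
Local Notation mu := (lebesgue_cube T).

(** Numbered by [nat], so that finitely many boxes are covered by an initial segment of indices. *)
Definition box_integral (m : nat) (u : W0 T) : R :=
  if choice.unpickle m is Some k then \int[mu]_(p in box k) W0_fun u p else 0.

Definition box_close (M : nat) (r : nat -> R) (e : R) (u : W0 T) : Prop :=
  forall m, (m < M)%N -> `|box_integral m u - r m| < e.

(* Otherwise points outside [U] would converge to [f] on every box, hence weakly. *)
Lemma open_box_close (U : set (W0 T)) (f : W0 T) : open U -> U f ->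
  exists M, forall g, box_close M (box_integral ^~ f) (M.+1%:R^-1) g -> U g.
Proof.
move=> oU Uf; apply: contrapT => /forallNP no.
have /choice[g gP] : forall M, exists g, box_close M (box_integral ^~ f) (M.+1%:R^-1) g /\ ~ U g.
  by move=> M; have /existsNP[g /not_implyP[]] := no M; exists g.
have gf : g n @[n --> \oo] --> f.
  apply: W0_cvg => // k; apply/cvgrPdist_lt => e e0.
  have [N _ hN] : \forall m \near \oo, m.+1%:R^-1 < e :> R.
    exact: near_infty_natSinv_lt (PosNum e0).
  (* Past the code of [k], the box of [k] is among those controlled by [g n]. *)
  exists (maxn N (choice.pickle k).+1) => // n /=; rewrite geq_max => /andP[Nn kn].
  have := (gP n).1 _ kn; rewrite /box_integral choice.pickleK distrC => /lt_trans; apply.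
  exact: hN.
have : nbhs f U by exact: open_nbhs_nbhs.
move=> /gf [N _ /(_ N (leqnn N))] /=.
exact: (gP N).2.
Qed.

(** Weakly open sets are tested by countably many box integrals, so it is enough that these depend
    measurably on the outcome. *)
Lemma W0_borel {d : measure_display} {Omega : measurableType d} (h : Omega -> W0 T) :
  (forall k, measurable_fun setT (fun w => \int[mu]_(p in box k) W0_fun (h w) p)) ->
  borel_measurable h.
Proof.
move=> mh.
have mb m : measurable_fun setT (fun w => box_integral m (h w)).
  by rewrite /box_integral; case: choice.unpickle => [k|]; [exact: mh|exact: measurable_cst].
have mopen (U : set (W0 T)) : open U -> measurable (h @^-1` U).
  move=> oU.
  (* [U] is a countable union of sets given by finitely many rational conditions. *)
  pose rad M : R := M.+1%:R^-1 / 2.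
  pose good (i : nat * seq rat) := `[< forall g, box_close i.1
    (fun m => ratr (nth 0 i.2 m)) (rad i.1) g -> U g >].
  pose V (i : nat * seq rat) : set Omega := if good i then
    [set w | box_close i.1 (fun m => ratr (nth 0 i.2 m)) (rad i.1) (h w)] else set0.
  have -> : h @^-1` U = \bigcup_i V i.
    apply/seteqP; split => [w /= Uw|w [[M r] _]]; last first.
      by rewrite /V; case: ifPn => // /asboolP gd /gd.
    have [M hM] := open_box_close oU Uw.
    have rad0 : 0 < rad M by rewrite divr_gt0// invr_gt0.
    have /choice[q hq] : forall m, exists q : rat, `|box_integral m (h w) - ratr q| < rad M.
      move=> m; have [|q] := @rat_in_itvoo R (box_integral m (h w) - rad M)
          (box_integral m (h w) + rad M).
        by rewrite ltrD2l gtrN.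
      rewrite in_itv/= => /andP[q1 q2]; exists q.
      by rewrite distrC ltr_distl q1 q2.
    have nq m : (m < M)%N -> nth 0 (mkseq q M) m = q m by move=> mM; rewrite nth_mkseq.
    exists (M, mkseq q M) => //; rewrite /V ifT/=.
      by move=> m /= mM; rewrite nq.
    apply/asboolP => g /= gq; apply: hM => m mM.
    have := gq m mM; rewrite nq// => h1; have h2 := hq m.
    (* Half of the radius is spent between [g] and the rational centre, half between [h w] and that
       centre. *)
    rewrite (_ : _ - _ = (box_integral m g - ratr (q m)) -
      (box_integral m (h w) - ratr (q m))); last by ring.
    by rewrite (le_lt_trans (ler_normB _ _))// [ltRHS]splitr ltrD.
  apply: countable_bigcupT_measurable => [|i]; first exact: countableP.
  rewrite /V; case: ifPn => // _.
  rewrite (_ : [set w | _] = \bigcap_m (if (m < i.1)%N then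
      [set w | `|box_integral m (h w) - ratr (nth 0 i.2 m)| < rad i.1] else setT)).
    apply: bigcapT_measurable => m; case: ifPn => // _.
    rewrite (_ : [set w | _] = (fun w => box_integral m (h w)) @^-1`
        ball (ratr (nth 0 i.2 m) : R) (rad i.1)).
      by rewrite -[_ @^-1` _]setTI; apply: mb => //; apply: measurable_ball.
    by apply/seteqP; split => w /=; rewrite /ball/= distrC.
  apply/seteqP; split => w /=.
    by move=> hw m _ /=; case: ifPn => // /hw.
  by move=> hw m mi; have := hw m I; rewrite mi.
apply: smallest_sub => //; split => /=.
- by rewrite preimage_set0.
- by move=> A mA; rewrite setTD preimage_setC; exact: measurableC.
- by move=> F mF; rewrite preimage_bigcup; exact: bigcupT_measurable.
Qed.

End W0_borel.

(** * Limit of the means *)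

Section rates_on_cube.
Context {R : realType} (T : R).
Hypothesis T_gt0 : 0 < T.
Local Notation mu := (lebesgue_cube T).
Local Notation R3 := (BR R * BR R * BR R)%type.
Local Notation lam := (@lebesgue_measure R).
Variables (c : R) (beta : R3 -> R) (betan : forall n, 'I_n -> 'I_n -> R -> R).
Hypothesis rates : admissible_rates T c beta betan.

(** The rates are controlled on the cube only. Extension by zero makes them measurable and
    nonnegative everywhere and is invisible to [lebesgue_cube]. *)
Definition cube_rate : R3 -> R := beta \_ (cube T).

Definition time_rate n (i j : 'I_n) : R -> R := betan i j \_ `[0, T].

Lemma cube_rate_ge0 p : 0 <= cube_rate p.
Proof.
rewrite /cube_rate patchE; case: ifPn => // /set_mem; exact: (rate_ge0 rates).
Qed.

Lemma measurable_cube_rate : measurable_fun setT cube_rate.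
Proof.
apply: (measurable_restrictT beta (measurable_cube T)).1.
by have h := rate_measurable rates.
Qed.

Lemma integrable_cube (f g : R3 -> R) : measurable_fun setT g ->
  (forall p, cube T p -> f p = g p) ->
  (@lebesgue3 R).-integrable (cube T) (EFin \o f) -> mu.-integrable setT (EFin \o g).
Proof.
move=> mg fg iF; apply: integrable_mrestr => //; first exact/measurable_EFinP.
rewrite setTI; apply: eq_integrable iF; first exact: measurable_cube.
by move=> p /set_mem/fg /= ->.
Qed.

Lemma integrable_cube_rate : mu.-integrable setT (EFin \o cube_rate).
Proof.
apply: integrable_cube (rate_L1 rates); first exact: measurable_cube_rate.
by move=> p cp; rewrite /cube_rate patchE mem_set.
Qed.

Lemma measurable_time_rate n (i j : 'I_n) : measurable_fun setT (time_rate i j).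
Proof.
apply: (measurable_restrictT (betan i j) _).1; first exact: measurable_itv.
by have h := raten_measurable rates i j.
Qed.

Lemma step_time_rateE n p : cube T p -> step (@betan n) p = step (@time_rate n) p.
Proof.
move=> cp; have [h|[i [j h]]] := stepP n p; rewrite !h//.
by rewrite /time_rate patchE mem_set//; case: cp.
Qed.

Lemma measurable_step_rate n : measurable_fun setT (step (@time_rate n) : R3 -> R).
Proof. by apply: measurable_step => i j; exact: measurable_time_rate. Qed.

Lemma integrable_step_rate n : mu.-integrable setT (EFin \o step (@time_rate n)).
Proof.
apply: integrable_cube (raten_L1 rates n); first exact: measurable_step_rate.
exact: step_time_rateE.
Qed.

Lemma cvg_step_rate :
  \int[mu]_p `|step (@time_rate n) p - cube_rate p| @[n --> \oo] --> (0 : R).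
Proof.
apply: fine_cvg; rewrite (_ : (fun n => _) = (fun n =>
  \int[@lebesgue3 R]_(p in cube T) (`|step (@betan n) p - beta p|%:E))%E).
  exact: (raten_cvg rates).
apply/funext => n; rewrite ge0_integral_mrestr//.
- rewrite setTI; apply: eq_integral => p /set_mem cp.
  by rewrite step_time_rateE// /cube_rate patchE mem_set.
- apply/measurable_EFinP; apply: measurableT_comp => //; apply: measurable_funB.
  + exact: measurable_step_rate.
  + exact: measurable_cube_rate.
Qed.

Lemma ae_cube : {ae mu, forall p, cube T p}.
Proof. by apply: ae_mrestr; apply: aeW. Qed.

(** On the cube, the shortfall of the limit rate below [c] is at most its distance to the
    approximating rate, which is at least [c]. By [L^1] convergence the shortfall has integral 0. *)
Lemma ae_cube_rate_ge : {ae mu, forall p, c <= cube_rate p}.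
Proof.
pose f p : R := (Num.max (c - cube_rate p) 0) * \1_(cube T) p.
have f0 p : 0 <= f p by rewrite mulr_ge0// le_max lexx orbT.
have mf : measurable_fun setT f.
  apply: measurable_funM; last by apply: measurable_indic; exact: measurable_cube.
  apply: measurable_maxr => //; apply: measurable_funB => //.
  exact: measurable_cube_rate.
have iD n : mu.-integrable setT (EFin \o (fun p => step (@time_rate n) p - cube_rate p)).
  exact: (integrableB measurableT (integrable_step_rate n) integrable_cube_rate).
have iN n : mu.-integrable setT (EFin \o (fun p => `|step (@time_rate n) p - cube_rate p|)).
  exact: integrable_norm (iD n).
have fle n p : (0 < n)%N -> f p <= `|step (@time_rate n) p - cube_rate p|.
  move=> n0; rewrite /f indicE; have [/set_mem cp|_] := boolP (p \in cube T); last by rewrite mulr0.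
  rewrite mulr1 ge_max normr_ge0 andbT (le_trans _ (ler_norm _))// lerB//.
  rewrite -step_time_rateE//; have [i [j ->]] := step_cube n0 cp.
  by apply: (raten_ge rates); case: cp => _ /=; rewrite in_itv.
have iF : mu.-integrable setT (EFin \o f).
  apply: le_integrable (iN 1%N) => //; first exact/measurable_EFinP.
  by move=> p _ /=; rewrite lee_fin normr_id ger0_norm// fle.
have If0 : \int[mu]_p f p = 0.
  apply/eqP; rewrite eq_le Rintegral_ge0// andbT.
  rewrite leNgt; apply/negP => I0.
  have /cvgr0Pnorm_lt/(_ _ I0)[N _ hN] := cvg_step_rate.
  have := hN (maxn N 1) (leq_maxl _ _); rewrite ltNge => /negP; apply.
  apply: le_trans (ler_norm _); apply: le_Rintegral => // p _.
  by apply: fle; rewrite leq_maxr.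
have /ae_eq_integral_abs : (\int[mu]_p `|(EFin \o f) p| = 0)%E.
  under eq_integral do rewrite gee0_abs ?lee_fin//.
  by rewrite -[LHS]fineK ?integrable_fin_num//; congr EFin.
move=> /(_ measurableT) fae.
have {}fae := fae (proj2 (measurable_EFinP _ _) mf).
apply: filterS2 ae_cube fae => p cp /(_ I) [].
rewrite /f indicE mem_set// mulr1 => h.
by rewrite -subr_le0 -h le_max lexx.
Qed.

Lemma integrable_time_rate : \forall n \near \oo, forall i j : 'I_n,
  lam.-integrable `[0, T] (EFin \o betan i j).
Proof.
apply: filterS (raten_blc rates) => n h i j; have [bij _] := h i j.
have Ioo : (lam `[0%R, T]%classic < +oo)%E.
  by rewrite lebesgue_measure_itv/=; case: ifP => // _; rewrite -EFinD ltry.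
apply: measurable_bounded_integrable => //; last by move: (raten_measurable rates i j).
Qed.

End rates_on_cube.

Section mean_limit.
Context {R : realType} {d : measure_display} {Omega : measurableType d}.
Variables (P : probability Omega R) (T : R).
Hypothesis T_gt0 : 0 < T.
Let T_ge0 : 0 <= T := ltW T_gt0.
Local Notation mu := (lebesgue_cube T).
Local Notation R3 := (BR R * BR R * BR R)%type.
Local Notation lam := (@lebesgue_measure R).
Variables (betap betam : R3 -> R) (betanp betanm : forall n, 'I_n -> 'I_n -> R -> R).
Variables (c : R) (a : nat -> R).
Hypothesis c_gt0 : 0 < c.
Hypothesis ratesp : admissible_rates T c betap betanp.
Hypothesis ratesm : admissible_rates T c betam betanm.
Hypothesis a_gt0 : forall n, (0 < n)%N -> 0 < a n.
Hypothesis a_cvg : a n @[n --> \oo] --> +oo.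
Variable x0 : forall n, 'I_n -> 'I_n -> bool.
Variable X : forall n, 'I_n -> 'I_n -> R -> {RV P >-> bool}.
Hypothesis X_chain : forall n (i j : 'I_n),
  jump_chain T (fun t => a n * betanp i j t) (fun t => a n * betanm i j t)
    (x0 i j) (X i j).

Let cX n (i j : 'I_n) omega : cadlag T (X i j ^~ omega).
Proof. by case: (X_chain i j). Qed.

Definition mean_step n : R3 -> R := step (fun i j : 'I_n => mean_path T (X i j)).

Lemma mean_step_itv n p : 0 <= mean_step n p <= 1.
Proof. by apply: step_itv01 => i j t; exact: mean_path_itv. Qed.

Lemma measurable_mean_step n : measurable_fun setT (mean_step n).
Proof. by apply: measurable_step => i j; exact: measurable_mean_path. Qed.

(* Equal to [0 / 0 = 0] off the cube. *)
Definition equilibrium (p : R3) : R :=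
  cube_rate T betap p / (cube_rate T betap p + cube_rate T betam p).

Let bp := cube_rate T betap.
Let bm := cube_rate T betam.
Let bp_ge0 p : 0 <= bp p. Proof. exact: (cube_rate_ge0 ratesp). Qed.
Let bm_ge0 p : 0 <= bm p. Proof. exact: (cube_rate_ge0 ratesm). Qed.
Let mbp : measurable_fun setT bp. Proof. exact: (measurable_cube_rate ratesp). Qed.
Let mbm : measurable_fun setT bm. Proof. exact: (measurable_cube_rate ratesm). Qed.
Let bpn n : R3 -> R := step (@time_rate R T betanp n).
Let bmn n : R3 -> R := step (@time_rate R T betanm n).

Let measurable_inv_rate : measurable_fun setT (fun p => (bp p + bm p)^-1).
Proof.
(* The inverse agrees with the measurable power of exponent -1 on nonnegative reals, 0 included. *)
rewrite (_ : (fun p => _) = (@powR R ^~ (-1)) \o (fun p => bp p + bm p)).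
  apply: measurableT_comp; first exact: measurable_powR.
  exact: measurable_funD.
by apply/funext => p /=; rewrite powR_inv1// addr_ge0.
Qed.

Lemma measurable_equilibrium : measurable_fun setT equilibrium.
Proof. exact: measurable_funM mbp measurable_inv_rate. Qed.

Lemma equilibrium_itv p : 0 <= equilibrium p <= 1.
Proof.
rewrite /equilibrium -/(bp p) -/(bm p); apply/andP; split.
  by rewrite divr_ge0// addr_ge0.
have := addr_ge0 (bp_ge0 p) (bm_ge0 p); rewrite le_eqVlt => /orP[/eqP <-|b0].
  by rewrite invr0 mulr0.
by rewrite ler_pdivrMr// mul1r lerDl.
Qed.

(** On [[0, T]], the integrand of the forward equation for the mean, divided by [a n]. *)
Let drift n (i j : 'I_n) (t : R) : R :=
  time_rate T betanp i j t - (time_rate T betanp i j t + time_rate T betanm i j t) *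
    mean_path T (X i j) t.

Let drift_stepE n p : step (@drift n) p = bpn n p - (bpn n p + bmn n p) * mean_step n p.
Proof.
rewrite /bpn /bmn /mean_step; have [h|[i [j h]]] := stepP n p; rewrite !h//.
by rewrite mulr0 subr0.
Qed.

(** The forward equation integrates from time 0, and rays unbounded to the left cut just such
    initial intervals out of [[0, T]]. *)
Let rational_ray_itv o : (exists2 t, 0 <= t <= T & rational_ray o `&` `[0, T] = `[0, t]%classic)
  \/ rational_ray o `&` `[0, T] = set0 :> set R.
Proof.
case: o => [q|]; last by left; exists T; rewrite ?setTI ?lexx ?T_ge0.
have [q0|q0] := ltP (ratr q) (0 : R).
  right; apply/seteqP; split => // x [] /=; rewrite !in_itv/= => xq /andP[x_ge0 _].
  by move: (le_trans x_ge0 xq); rewrite leNgt q0.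
left; exists (Num.min (ratr q) T); first by rewrite le_min q0 T_ge0 ge_min lexx orbT.
apply/seteqP; split => x /=; rewrite !in_itv/= le_min.
  by move=> [-> /andP[-> ->]].
by move=> /andP[-> /andP[-> ->]].
Qed.

(** Each of the [n^2] time integrals is at most [(a n)^-1] and has weight at most [n^-2], whatever
    the box. *)
Let drift_box : \forall n \near \oo, forall k,
  `|\int[mu]_(p in box k) step (@drift n) p| <= (a n)^-1.
Proof.
near=> n => k.
have n0 : (0 < n)%N by near: n; exact: nbhs_infty_gt.
have ip i j : lam.-integrable `[0, T] (EFin \o @betanp n i j).
  move: i j; near: n; exact: (integrable_time_rate ratesp).
have im i j : lam.-integrable `[0, T] (EFin \o @betanm n i j).
  move: i j; near: n; exact: (integrable_time_rate ratesm).
have an := a_gt0 n0.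
have mI : measurable (`[0, T]%classic : set (BR R)) by exact: measurable_itv.
have itr (b : forall n, 'I_n -> 'I_n -> R -> R) (i j : 'I_n) :
    lam.-integrable `[0, T] (EFin \o b n i j) ->
    lam.-integrable `[0, T] (EFin \o time_rate T b i j).
  apply: eq_integrable => // t tT /=.
  by rewrite /time_rate patchE tT.
have mm i j : measurable_fun setT (mean_path T (X (n := n) i j)) by exact: measurable_mean_path.
have mtp (i j : 'I_n) : measurable_fun setT (time_rate T betanp i j).
  by have := measurable_time_rate ratesp i j.
have mtm (i j : 'I_n) : measurable_fun setT (time_rate T betanm i j).
  by have := measurable_time_rate ratesm i j.
have md (i j : 'I_n) : measurable_fun setT (drift i j).
  have mD := measurable_funD (mtp i j) (mtm i j).
  exact: (measurable_funB (mtp i j) (measurable_funM mD (mm i j))).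
have idr (i j : 'I_n) : lam.-integrable `[0, T] (EFin \o drift i j).
  have bounded_mul (f : R -> R) : measurable_fun setT f -> lam.-integrable `[0, T] (EFin \o f) ->
      lam.-integrable `[0, T] (EFin \o (fun t => f t * mean_path T (X i j) t)).
    move=> mf jf; apply: le_integrable jf => //.
      apply/measurable_EFinP; have h := measurable_funM mf (mm i j).
      exact: measurable_funS h.
    move=> t _ /=; rewrite lee_fin normrM ler_piMr//.
    by have /andP[? ?] := mean_path_itv T (X i j) t; rewrite ger0_norm.
  have h1 := bounded_mul _ (mtp i j) (itr betanp i j (ip i j)).
  have h2 := bounded_mul _ (mtm i j) (itr betanm i j (im i j)).
  have := integrableB mI (itr betanp i j (ip i j)) (integrableD mI h1 h2).
  by apply: eq_integrable => // t _ /=; rewrite /drift mulrDl.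
rewrite Rintegral_step//; [|exact: measurable_rational_ray..].
have I1 (i j : 'I_n) : `|\int[lam]_(t in rational_ray k.2 `&` `[0, T]) drift i j t| <= (a n)^-1.
  have [[t t0T ->]|->] := rational_ray_itv k.2; last first.
    by rewrite Rintegral_set0 normr0 invr_ge0 ltW.
  rewrite (_ : \int[lam]_(_ in _) _ = \int[lam]_(u in `[0, t]%classic)
     (betanp i j u - (betanp i j u + betanm i j u) * mean_path T (X i j) u)).
    exact: (chain_drift_le T_ge0 an (X_chain i j) t0T (ip i j) (im i j)).
  apply: eq_Rintegral => u /set_mem/=; rewrite in_itv/= => /andP[u0 ut].
  have uT : u \in `[0, T]%classic.
    by apply/mem_set; rewrite /= in_itv/= u0 (le_trans ut)//; case/andP: t0T.
  by rewrite /drift /time_rate !patchE uT.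
have nR : n%:R != 0 :> R by rewrite pnatr_eq0 -lt0n.
rewrite (le_trans (ler_norm_sum _ _ _))//.
apply: (@le_trans _ _ (\sum_(i < n) \sum_(j < n) n%:R^-1 * n%:R^-1 * (a n)^-1)).
  apply: ler_sum => i _; rewrite (le_trans (ler_norm_sum _ _ _))//.
  apply: ler_sum => j _; rewrite normrM ler_pM// ger0_norm ?cell_weight_ge0//.
  by apply: cell_weight_le; exact: measurable_rational_ray.
rewrite !sumr_const card_ord -mulrnA -[leLHS]mulr_natr natrM.
rewrite le_eqVlt; apply/orP; left; apply/eqP; field.
by rewrite nR lt0r_neq0.
Unshelve. all: by end_near. Qed.

(* Equal to [(bp + bm) * (equilibrium - mean_step n)], the rates being nonnegative. *)
Let F n p : R := bp p - (bp p + bm p) * mean_step n p.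

Let measurable_F n : measurable_fun setT (F n).
Proof.
have mD := measurable_funD mbp mbm.
exact: (measurable_funB mbp (measurable_funM mD (@measurable_mean_step n))).
Qed.

Let F_le n p : `|F n p| <= bp p + bm p.
Proof.
have /andP[U0 U1] := mean_step_itv n p; have := bp_ge0 p; have := bm_ge0 p.
by rewrite /F ler_norml => m0 p0; apply/andP; split; nra.
Qed.

Let ibp : mu.-integrable setT (EFin \o bp). Proof. exact: (integrable_cube_rate ratesp). Qed.
Let ibm : mu.-integrable setT (EFin \o bm). Proof. exact: (integrable_cube_rate ratesm). Qed.
Let ib : mu.-integrable setT (EFin \o (fun p => bp p + bm p)).
Proof. exact: (integrableD measurableT ibp ibm). Qed.

Let iF n : mu.-integrable setT (EFin \o F n).
Proof.
apply: le_integrable ib => //; first exact/measurable_EFinP.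
by move=> p _; rewrite lee_fin; exact: le_trans (F_le n p) (ler_norm _).
Qed.

(** Passing from the approximating rates to the limit ones costs at most the two [L^1] errors,
    because they are multiplied by [1 - mean_step n] and [mean_step n], both in [[0, 1]]. *)
Let F_box k : \int[mu]_(p in box k) F n p @[n --> \oo] --> (0:R).
Proof.
have mk := @measurable_box R k.
pose dp n p : R := `|bpn n p - bp p|.
pose dm n p : R := `|bmn n p - bm p|.
have ibpn n : mu.-integrable setT (EFin \o bpn n) by exact: (integrable_step_rate ratesp).
have ibmn n : mu.-integrable setT (EFin \o bmn n) by exact: (integrable_step_rate ratesm).
have idp n : mu.-integrable setT (EFin \o dp n).
  exact: integrable_norm (integrableB measurableT (ibpn n) ibp).
have idm n : mu.-integrable setT (EFin \o dm n).
  exact: integrable_norm (integrableB measurableT (ibmn n) ibm).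
have idd n : mu.-integrable setT (EFin \o (fun p => dp n p + dm n p)).
  exact: (integrableD measurableT (idp n) (idm n)).
have d0 n p : 0 <= dp n p + dm n p by exact: addr_ge0 (normr_ge0 _) (normr_ge0 _).
have mdrift n : measurable_fun setT (step (@drift n) : R3 -> R).
  rewrite (funext (@drift_stepE n)).
  have m1 : measurable_fun setT (bpn n) by exact: (measurable_step_rate ratesp).
  have m2 : measurable_fun setT (bmn n) by exact: (measurable_step_rate ratesm).
  have mD := measurable_funD m1 m2.
  exact: (measurable_funB m1 (measurable_funM mD (@measurable_mean_step n))).
have Fd n p : `|F n p - step (@drift n) p| <= dp n p + dm n p.
  have /andP[U0 U1] := mean_step_itv n p.
  rewrite drift_stepE /F (_ : _ - _ = (bmn n p - bm p) * mean_step n p -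
    (bpn n p - bp p) * (1 - mean_step n p)); last by ring.
  rewrite (le_trans (ler_normB _ _))// addrC lerD// normrM ler_piMr//.
    by rewrite ger0_norm ?subr_ge0// gerBl.
  by rewrite ger0_norm.
have iFd n : mu.-integrable setT (EFin \o (fun p => F n p - step (@drift n) p)).
  apply: le_integrable (idd n) => //.
    apply/measurable_EFinP; exact: (measurable_funB (@measurable_F n) (mdrift n)).
  by move=> p _; rewrite lee_fin; exact: le_trans (Fd n p) (ler_norm _).
have idr n : mu.-integrable setT (EFin \o (step (@drift n) : R3 -> R)).
  rewrite (_ : step (@drift n) = fun p => F n p - (F n p - step (@drift n) p)).
    exact: (integrableB measurableT (iF n) (iFd n)).
  by apply/funext => p; rewrite opprB addrCA subrr addr0.
have sub (f : R3 -> R) : mu.-integrable setT (EFin \o f) -> mu.-integrable (box k) (EFin \o f).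
  by move=> jf; exact: integrableS jf.
have bound : \forall n \near \oo, 0 <= `|\int[mu]_(p in box k) F n p| <=
    (a n)^-1 + (\int[mu]_p dp n p + \int[mu]_p dm n p).
  apply: filterS drift_box => n /(_ k) dn; rewrite normr_ge0/=.
  have -> : \int[mu]_(p in box k) F n p = \int[mu]_(p in box k) step (@drift n) p +
      \int[mu]_(p in box k) (F n p - step (@drift n) p).
    rewrite -(RintegralD mk (sub _ (idr n)) (sub _ (iFd n))).
    by apply: eq_Rintegral => p _; rewrite addrC subrK.
  rewrite (le_trans (ler_normD _ _))// lerD//.
  rewrite (le_trans (le_normr_Rintegral mk (sub _ (iFd n))))//.
  rewrite -(RintegralD measurableT (idp n) (idm n)).
  apply: (@le_trans _ _ (\int[mu]_(p in box k) (dp n p + dm n p))).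
    apply: le_Rintegral => //; last exact: sub.
    exact: integrable_norm (sub _ (iFd n)).
  rewrite -subr_ge0 -(Rintegral_setD measurableT mk (@subsetT _ _) (idd n)).
  by apply: Rintegral_ge0 => p _; exact: d0.
apply: norm_cvg0; apply: (squeeze_cvgr bound (cvg_cst 0)).
have ainv : (a n)^-1 @[n --> \oo] --> (0:R).
  apply/gtr0_cvgV0 => //; exists 1%N => // n /=; exact: a_gt0.
have : (fun n => (a n)^-1 + (\int[mu]_p dp n p + \int[mu]_p dm n p)) @ \oo -->
    (0 + (0 + 0) : R).
  by apply: cvgD ainv _; apply: cvgD; [exact: (cvg_step_rate ratesp)|exact: (cvg_step_rate ratesm)].
by rewrite !addr0.
Qed.

Lemma mean_step_cvg k : \int[mu]_(p in box k) mean_step n p @[n --> \oo] -->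
  \int[mu]_(p in box k) equilibrium p.
Proof.
have mk := @measurable_box R k.
pose g p : R := \1_(box k) p * (bp p + bm p)^-1.
have mg : measurable_fun setT g.
  apply: measurable_funM => //; exact: measurable_indic.
(* The product is at most 1, also where the weight vanishes, since [0^-1 = 0]. *)
have ibg : mu.-integrable setT (EFin \o (fun p => (bp p + bm p) * g p)).
  apply: (integrable_cube_bounded T_gt0 (k := 1)).
    by apply: measurable_funM => //; exact: measurable_funD.
  move=> p; rewrite /g mulrCA normrM.
  have h1 : `|\1_(box k) p| <= 1 :> R by rewrite indicE; case: (_ \in _); rewrite ?normr1 ?normr0.
  apply: mulr_ile1 => //; have [->|b0] := eqVneq (bp p + bm p) 0; first by rewrite mul0r normr0.
  by rewrite divff// normr1.
have FC A : range box A -> \int[mu]_(x in A) F n x @[n --> \oo] --> (0:R).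
  by move=> [l _ <-]; exact: F_box.
have Fg := dominated_weak_cvg measurable_F F_le ib boxI box_generate boxT FC mg ibg.
have iE : mu.-integrable (box k) (EFin \o equilibrium).
  apply: (@integrableS _ _ _ _ setT) => //.
  apply: (integrable_cube_bounded T_gt0 (k := 1)); first exact: measurable_equilibrium.
  by move=> p; have /andP[h1 h2] := equilibrium_itv p; rewrite ger0_norm.
have iM n : mu.-integrable (box k) (EFin \o mean_step n).
  apply: (@integrableS _ _ _ _ setT) => //.
  apply: (integrable_cube_bounded T_gt0 (k := 1)); first exact: measurable_mean_step.
  by move=> p; have /andP[h1 h2] := mean_step_itv n p; rewrite ger0_norm.
have FE n : \int[mu]_p (F n p * g p) =
    \int[mu]_(p in box k) equilibrium p - \int[mu]_(p in box k) mean_step n p.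
  rewrite -(RintegralB mk iE (iM n)) [RHS]Rintegral_mkcond; congr fine.
  apply: ae_eq_integral => //.
  - apply/measurable_EFinP; exact: measurable_funM.
  - apply/measurable_EFinP.
    apply: (measurable_restrictT (fun p => equilibrium p - mean_step n p) mk).1.
    have h := measurable_funB measurable_equilibrium (@measurable_mean_step n).
    exact: (measurable_funS measurableT (@subsetT _ _) h).
  (* Cancelling the weight is legitimate almost everywhere, both limit rates being at least [c]
     there. *)
  apply: filterS2 (ae_cube_rate_ge ratesp) (ae_cube_rate_ge ratesm) => p cp cm _ /=.
  have b0 : 0 < bp p + bm p by rewrite (lt_le_trans (addr_gt0 c_gt0 c_gt0))// lerD.
  rewrite patchE /g indicE /F /equilibrium -/(bp p) -/(bm p); case: ifPn => _ /=; congr EFin.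
    by rewrite mul1r mulrBl mulrAC divff ?lt0r_neq0// mul1r.
  by rewrite mul0r mulr0.
rewrite (funext FE) in Fg; set l := \int[mu]_(p in box k) equilibrium p in Fg *.
have : (fun n => l - (l - \int[mu]_(p in box k) mean_step n p)) @ \oo --> l - 0.
  by apply: cvgB => //; exact: cvg_cst.
rewrite subr0; apply: cvg_trans; apply: near_eq_cvg; apply: nearW => n /=.
by rewrite opprB addrCA subrr addr0.
Qed.

End mean_limit.

(** * Almost sure weak convergence from fluctuations and means *)

Theorem theorem3p2 (R : realType) (T : R) (T_gt0 : 0 < T)
  (d : measure_display) (Omega : measurableType d) (P : probability Omega R)
  (betap betam : BR R * BR R * BR R -> R)
  (betanp betanm : forall n, 'I_n -> 'I_n -> R -> R)
  (c : R) (c_gt0 : 0 < c)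
  (ratesp : admissible_rates T c betap betanp)
  (ratesm : admissible_rates T c betam betanm)
  (a : nat -> R) (a_gt0 : forall n, (0 < n)%N -> 0 < a n)
  (a_cvg : a n @[n --> \oo] --> +oo)
  (x0 : forall n, 'I_n -> 'I_n -> bool)
  (X : forall n, 'I_n -> 'I_n -> R -> {RV P >-> bool})
  (X_chain : forall n (i j : 'I_n),
    jump_chain T (fun t => a n * betanp n i j t)
      (fun t => a n * betanm n i j t) (x0 n i j) (X n i j))
  (X_indep : forall n, mutually_independent P
    (fun ij : 'I_n * 'I_n => history (X n ij.1 ij.2) T)) :
  let H n omega := step (fun i j t => (X n i j t omega)%:R : R) in
  let w p := betap p / (betap p + betam p) in
  exists (h : nat -> Omega -> W0 T) (w0 : W0 T),
    [/\ forall n omega,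
          (set_val (h n omega) : L2 T) = H n omega %[ae lebesgue_cube T],
        (set_val w0 : L2 T) = w %[ae lebesgue_cube T],
        forall n, borel_measurable (h n) &
        {ae P, forall omega, h n omega @[n --> \oo] --> w0}].
Proof.
move=> H w; have T_ge0 : 0 <= T := ltW T_gt0.
have cX n i j omega : cadlag T (X n i j ^~ omega) by case: (X_chain n i j).
(* Clamping the time gives joint measurability and changes nothing on the cube. *)
pose Z n (i j : 'I_n) (p : BR R * Omega) : R := (X n i j (clamp T p.1) p.2)%:R.
have mZ n i j : measurable_fun setT (Z n i j).
  have mX : forall t, measurable_fun setT (X n i j t) by [].
  exact: (measurable_process T_ge0 mX (cX n i j)).
have Z01 n i j p : 0 <= Z n i j p <= 1 by rewrite /Z; case: (X _ _ _ _ _); rewrite lexx ler01.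
have Z1 n i j p : `|Z n i j p| <= 1 by have /andP[h1 h2] := Z01 n i j p; rewrite ger0_norm.
have mZw n i j omega : measurable_fun setT (fun t : R => Z n i j (t, omega)).
  exact: (measurableT_comp (mZ n i j) (measurable_pair2 omega)).
have mI : measurable (`[0, T]%classic : set (BR R)) by exact: measurable_itv.
have Ioo : (@lebesgue_measure R `[0%R, T]%classic < +oo)%E.
  by rewrite lebesgue_measure_itv/=; case: ifP => // _; rewrite -EFinD ltry.
have iZ n i j omega := integrable_section (mZ n i j) (Z1 n i j) mI Ioo omega.
pose H' n omega : BR R * BR R * BR R -> R := step (fun i j t => Z n i j (t, omega)).
have mH' n omega : measurable_fun setT (H' n omega) by exact: measurable_step.
have H'01 n omega p : 0 <= H' n omega p <= 1 by apply: step_itv01.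
(* The classes are picked separately for each outcome; measurability in the outcome is recovered
   below through [W0_borel]. *)
have /choice[h0 h0P] : forall nw : nat * Omega, exists u : W0 T,
    W0_fun u = H' nw.1 nw.2 %[ae lebesgue_cube T].
  by move=> nw; exact: exists_W0.
have [w0 w0P] := exists_W0 T_gt0 (measurable_equilibrium ratesp ratesm)
  (equilibrium_itv ratesp ratesm).
pose h n omega := h0 (n, omega); have hP n omega := h0P (n, omega).
have W0_integral (u : W0 T) f k : measurable_fun setT f ->
    W0_fun u = f %[ae lebesgue_cube T] ->
    \int[lebesgue_cube T]_(p in box k) W0_fun u p = \int[lebesgue_cube T]_(p in box k) f p.
  move=> mf uf; have mk := @measurable_box R k; congr fine; apply: ae_eq_integral => //.
  - by apply/measurable_EFinP; exact: measurable_funS (@measurable_W0_fun _ _ u).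
  - by apply/measurable_EFinP; exact: measurable_funS mf.
  - by apply: filterS uf => p /(_ I) -> _.
exists h, w0; split.
- move=> n omega; apply: filterS2 (@ae_cube R T) (hP n omega) => p cp /(_ I) e _.
  rewrite [LHS]e /H' /H; have [e0|[i [j e0]]] := stepP n p; rewrite !e0//.
  by rewrite /Z/= clamp_id//; case: cp => _; rewrite /= in_itv.
- apply: filterS2 (@ae_cube R T) w0P => p cp /(_ I) e _.
  by rewrite [LHS]e /equilibrium /cube_rate /w !patchE mem_set.
- move=> n; apply: W0_borel => // k.
  rewrite (_ : (fun omega => _) = (fun omega => \sum_(i < n) \sum_(j < n)
    cell_weight (rational_ray k.1.1) (rational_ray k.1.2) i j *
    \int[@lebesgue_measure R]_(t in rational_ray k.2 `&` `[0, T]) Z n i j (t, omega))).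
    apply: measurable_sum => i; apply: measurable_sum => j.
    apply: measurable_funM => //; apply: (measurable_time_integral P (mZ n i j) (Z1 n i j)).
      by apply: measurableI => //; exact: measurable_rational_ray.
    apply: le_lt_trans Ioo; apply: le_measure; try apply: mem_set => //.
      by apply: measurableI => //; exact: measurable_rational_ray.
    exact: subIsetr.
  apply/funext => omega; rewrite (W0_integral _ _ k (mH' n omega) (hP n omega)).
  exact: (Rintegral_step (measurable_rational_ray _) (measurable_rational_ray _)
    (measurable_rational_ray _) (fun i j => mZw n i j omega) (fun i j => iZ n i j omega)).
have fluct k : {ae P, forall omega, \int[lebesgue_cube T]_(p in box k)
    step (fun i j t => centered T (X n i j) (t, omega)) p @[n --> \oo] --> (0 : R)}.
  exact: (ae_cvg_fluctuation T_gt0 cX X_indep (measurable_rational_ray _)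
    (measurable_rational_ray _) (measurable_rational_ray _)).
(* Numbering the boxes by [nat] yields a single null set for all of them. *)
have {}fluct : {ae P, forall omega, forall m, if choice.unpickle m is Some k then
    \int[lebesgue_cube T]_(p in box k)
    step (fun i j t => centered T (X n i j) (t, omega)) p @[n --> \oo] --> (0 : R) else True}.
  apply: ae_foralln => m; case: choice.unpickle => [k|]; first exact: fluct.
  exact: aeW.
apply: filterS fluct => omega fl.
apply: W0_cvg => // k; have := fl (choice.pickle k); rewrite choice.pickleK => {}fl.
have mk := @measurable_box R k.
rewrite (W0_integral w0 _ k (measurable_equilibrium ratesp ratesm) w0P).
have mean := mean_step_cvg T_gt0 c_gt0 ratesp ratesm a_gt0 a_cvg X_chain (k := k).
have sub (f : BR R * BR R * BR R -> R) : measurable_fun setT f -> (forall p, 0 <= f p <= 1) ->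
    (lebesgue_cube T).-integrable (box k) (EFin \o f).
  move=> mf f01; apply: (@integrableS _ _ _ _ setT) => //.
  apply: (integrable_cube_bounded T_gt0 (k := 1)) => // p.
  by have /andP[h1 h2] := f01 p; rewrite ger0_norm.
have : (fun n => \int[lebesgue_cube T]_(p in box k)
      step (fun i j t => centered T (X n i j) (t, omega)) p +
    \int[lebesgue_cube T]_(p in box k) mean_step T X n p) @ \oo -->
    0 + \int[lebesgue_cube T]_(p in box k) equilibrium T betap betam p.
  by apply: cvgD; [exact: fl|exact: mean].
rewrite add0r; apply: cvg_trans; apply: near_eq_cvg; apply: nearW => n /=.
rewrite (W0_integral _ _ k (mH' n omega) (hP n omega)).
have mM : measurable_fun setT (mean_step T X n) by exact: (measurable_mean_step T_gt0 X_chain).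
rewrite -[X in _ = X](subrK (\int[lebesgue_cube T]_(p in box k) mean_step T X n p)).
congr (_ + _); rewrite -RintegralB//; first last.
- by apply: sub => //; exact: mean_step_itv.
- exact: sub.
by apply: eq_Rintegral => p _; rewrite /H' /mean_step stepB.
Qed.
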